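(* Let $k$ be a field and let $A$ be a commutative $k$-algebra. The non-symmetric operad $\{C^n_{S^2}(A,A)\}_{n\ge 1}$ with the partial compositions $\circ_i$ is multiplicative, with multiplication the element $\mathfrak m\in C^2_{S^2}(A,A)=\mathrm{Hom}_k(A,A)$ given by $\mathfrak m\begin{pmatrix}1&a\\&1\end{pmatrix}=a$; that is, $\mathfrak m\circ\mathfrak m=0$. In particular, there is a homotopy $G$-algebra structure on $\bigoplus_{n\ge 1}C^n_{S^2}(A,A)$, given by the braces of the operad, the cup product $x\cdot y=(-1)^{|x|+1}\mathfrak m\{x,y\}$ and the differential $dx=\mathfrak m\circ x-(-1)^{|x|}x\circ\mathfrak m$.
   Context: All tensor products are over $k$; algebras are associative and unital. **The spaces and partial compositions.** For $n\ge 1$ let $C^n_{S^2}(A,A)=\mathrm{Hom}_k(A^{\otimes n(n-1)/2},A)$ (with $A^{\otimes 0}=k$). A simple tensor in $A^{\otimes n(n-1)/2}$ is written as a strictly upper triangular array $T=(a_{p,q})_{1\le p<q\le n}$ of elements of $A$ (displayed as an $n\times n$ upper triangular matrix with $1$'s on the diagonal, which play no role). For $f\in C^n_{S^2}(A,A)$, $g\in C^m_{S^2}(A,A)$ and $1\le i\le n$, define $f\circ_i g\in C^{n+m-1}_{S^2}(A,A)$ on $T=(a_{p,q})_{1\le p<q\le n+m-1}$ by $$(f\circ_i g)(T)=f\big((b_{r,s})_{1\le r<s\le n}\big)\,g\big((a_{p,q})_{i\le p<q\le i+m-1}\big),\qquad b_{r,s}=\prod_{p<q,\ \pi(p)=r,\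 \pi(q)=s}a_{p,q},$$ where $\pi:\{1,\dots,n+m-1\}\to\{1,\dots,n\}$ is $\pi(p)=p$ for $p<i$, $\pi(p)=i$ for $i\le p\le i+m-1$, and $\pi(p)=p-m+1$ for $p\ge i+m$. These maps, together with the element $\mathbf 1\in C^1_{S^2}(A,A)=\mathrm{Hom}_k(k,A)$, $\alpha\mapsto\alpha\cdot 1_A$, form a non-symmetric unital operad. **Operadic operations.** For $x\in C^n_{S^2}(A,A)$ write $|x|=n-1$. Put $x\circ y=\sum_{i=1}^{n}(-1)^{(i-1)|y|}x\circ_i y$ for $x\in C^n_{S^2}(A,A)$. A multiplication on the operad is an element $\mathfrak m$ of its arity-$2$ part with $\mathfrak m\circ\mathfrak m=0$; an operad with a multiplication is called multiplicative. The braces are, for $x\in C^n_{S^2}(A,A)$ and $r\ge 1$, $$x\{x_1,\dots,x_r\}=\sum_{1\le i_1<\cdots<i_r\le n}(-1)^{\varepsilon}\big(\cdots((x\circ_{i_r}x_r)\circ_{i_{r-1}}x_{r-1})\cdots\big)\circ_{i_1}x_1,\qquad \varepsilon=\sum_{p=1}^r|x_p|\Big(i_p-1+\sum_{q<p}|x_q|\Big),$$ (zero if $r>n$), and $x\{\}=x$; in particular $x\{y\}=x\circ y$. **Homotopy $G$-algebra.** A homotopy $G$-algebra is a graded $k$-vector space $V=\bigoplus_n V^n$ (with $|x|=n-1$ for $x\in V^n$) with multilinear braces $x\{x_1,\dots,x_r\}$ ($r\ge0$, $x\{\}=x$, $|x\{x_1,\dots,x_r\}|=|x|+\sum|x_p|$),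 a product $\cdot:V^n\otimes V^m\to V^{n+m}$ and a map $d:V^n\to V^{n+1}$ such that: (a) $x\{x_1,\dots,x_m\}\{y_1,\dots,y_n\}=\sum_{0\le i_1\le j_1\le\cdots\le i_m\le j_m\le n}(-1)^{\varepsilon}\,x\{y_1,\dots,y_{i_1},x_1\{y_{i_1+1},\dots,y_{j_1}\},y_{j_1+1},\dots,y_{i_m},x_m\{y_{i_m+1},\dots,y_{j_m}\},y_{j_m+1},\dots,y_n\}$ with $\varepsilon=\sum_{p=1}^m|x_p|\sum_{q=1}^{i_p}|y_q|$; (b) the product is associative, $d^2=0$, and $d(x\cdot y)=dx\cdot y+(-1)^{|x|+1}x\cdot dy$; (c) $(x\cdot y)\{z_1,\dots,z_n\}=\sum_{k=0}^n(-1)^{(|y|+1)\sum_{p=1}^k|z_p|}\,x\{z_1,\dots,z_k\}\cdot y\{z_{k+1},\dots,z_n\}$; (d) for $N\ge 1$, with $S_i=|x_1|+\cdots+|x_i|$, $$d(x\{x_1,\dots,x_N\})-(dx)\{x_1,\dots,x_N\}-(-1)^{|x|}\sum_{i=1}^N(-1)^{S_{i-1}}x\{x_1,\dots,dx_i,\dots,x_N\}$$ $$=(-1)^{(|x|+1)|x_1|}x_1\cdot x\{x_2,\dots,x_N\}+(-1)^{|x|+S_{N-1}}x\{x_1,\dots,x_{N-1}\}\cdot x_N-(-1)^{|x|}\sum_{i=1}^{N-1}(-1)^{S_i}x\{x_1,\dots,x_i\cdot x_{i+1},\dots,x_N\}.$$ *)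

(* Defs.v *)
From HB Require Import structures.
From mathcomp Require Import all_boot all_order all_algebra.
From mathcomp Require Import boolp functions.
From mathcomp Require Import zify.

Set Implicit Arguments.
Unset Strict Implicit.
Unset Printing Implicit Defensive.

Import GRing.Theory.
Local Open Scope ring_scope.

(* The component [P n] has arity [n.+1], so that [n] is the degree |x| of its
   elements, and inputs are numbered from 0. Elements of components whose
   arities agree only up to a rewriting of the index are compared as dependent
   pairs in [{n & P n}]. *)
Record nsOperad (k : fieldType) := NSOperad {
  opP :> nat -> lmodType k;
  pcomp : forall n m, opP n -> 'I_n.+1 -> opP m -> opP (n + m);
  op1 : opP 0;
  pcompDZl : forall n m (i : 'I_n.+1) (y : opP m),
    linear (fun x : opP n => pcomp x i y);
  pcompDZr : forall n m (x : opP n) (i : 'I_n.+1),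
    linear (fun y : opP m => pcomp x i y);
  pcompA_seq : forall l m n (x : opP l) (y : opP m) (z : opP n)
      (i : 'I_l.+1) (j : 'I_m.+1),
    Tagged opP (pcomp (pcomp x i y) (inord (i + j)) z)
    = Tagged opP (pcomp x i (pcomp y j z));
  pcompA_par : forall l m n (x : opP l) (y : opP m) (z : opP n)
      (i j : 'I_l.+1), (i < j)%N ->
    Tagged opP (pcomp (pcomp x i y) (inord (j + m)) z)
    = Tagged opP (pcomp (pcomp x j z) (inord i) y);
  pcomp1l : forall n (x : opP n), Tagged opP (pcomp op1 ord0 x) = Tagged opP x;
  pcomp1r : forall n (x : opP n) (i : 'I_n.+1),
    Tagged opP (pcomp x i op1) = Tagged opP x
}.

Definition circ (k : fieldType) (O : nsOperad k) n m (x : O n) (y : O m) :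
    O (n + m)%N :=
  \sum_(i < n.+1) (-1) ^+ (i * m) *: pcomp x i y.

Definition is_multiplication (k : fieldType) (O : nsOperad k) (mu : O 1%N) :=
  circ mu mu = 0.

Section DirectSum.
Variables (k : fieldType) (P : nat -> lmodType k).

Definition finsupp (x : forall n, P n) :=
  exists N, forall n, (N <= n)%N -> x n = 0.

Record dsum := DSum { dcomp :> forall n, P n; _ : `[< finsupp dcomp >] }.

Lemma dsum_finsupp (x : dsum) : finsupp x.
Proof. by case: x => x /= /asboolP. Qed.

Lemma dsumP (x y : dsum) : (forall n, x n = y n) -> x = y.
Proof.
case: x y => [x Hx] [y Hy] /= xy.
have E : x = y by exact: functional_extensionality_dep.
by case: _ / E Hy => Hy; rewrite (bool_irrelevance Hx Hy).
Qed.

HB.instance Definition _ := gen_eqMixin dsum.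
HB.instance Definition _ := gen_choiceMixin dsum.

Lemma dsum0_subproof : `[< finsupp (fun n => 0 : P n) >].
Proof. by apply/asboolP; exists 0%N. Qed.
Definition dsum0 := DSum dsum0_subproof.

Lemma dsumN_subproof (x : dsum) : `[< finsupp (fun n => - x n) >].
Proof.
by apply/asboolP; have [N xN] := dsum_finsupp x; exists N => n /xN->; rewrite oppr0.
Qed.
Definition dsumN x := DSum (dsumN_subproof x).

Lemma dsumD_subproof (x y : dsum) : `[< finsupp (fun n => x n + y n) >].
Proof.
apply/asboolP; have [N xN] := dsum_finsupp x; have [M yM] := dsum_finsupp y.
by exists (maxn N M) => n; rewrite geq_max => /andP[/xN-> /yM->]; rewrite addr0.
Qed.
Definition dsumD x y := DSum (dsumD_subproof x y).

Lemma dsumZ_subproof (a : k) (x : dsum) : `[< finsupp (fun n => a *: x n) >].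
Proof.
by apply/asboolP; have [N xN] := dsum_finsupp x; exists N => n /xN->; rewrite scaler0.
Qed.
Definition dsumZ a x := DSum (dsumZ_subproof a x).

Lemma dsum_addA : associative dsumD.
Proof. by move=> x y z; apply: dsumP => n /=; rewrite addrA. Qed.
Lemma dsum_addC : commutative dsumD.
Proof. by move=> x y; apply: dsumP => n /=; rewrite addrC. Qed.
Lemma dsum_add0 : left_id dsum0 dsumD.
Proof. by move=> x; apply: dsumP => n /=; rewrite add0r. Qed.
Lemma dsum_addN : left_inverse dsum0 dsumN dsumD.
Proof. by move=> x; apply: dsumP => n /=; rewrite addNr. Qed.

HB.instance Definition _ :=
  GRing.isZmodule.Build dsum dsum_addA dsum_addC dsum_add0 dsum_addN.

Lemma dsum_scaleA a b x : dsumZ a (dsumZ b x) = dsumZ (a * b) x.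
Proof. by apply: dsumP => n /=; rewrite scalerA. Qed.
Lemma dsum_scale1 : left_id 1 dsumZ.
Proof. by move=> x; apply: dsumP => n /=; rewrite scale1r. Qed.
Lemma dsum_scaleDr : right_distributive dsumZ +%R.
Proof. by move=> a x y; apply: dsumP => n /=; rewrite scalerDr. Qed.
Lemma dsum_scaleDl x : {morph dsumZ^~ x : a b / a + b}.
Proof. by move=> a b; apply: dsumP => n /=; rewrite scalerDl. Qed.

HB.instance Definition _ := GRing.Zmodule_isLmodule.Build k dsum
  dsum_scaleA dsum_scale1 dsum_scaleDr dsum_scaleDl.

Definition dinj_fun n (x : P n) (m : nat) : P m :=
  if n =P m is ReflectT e then eq_rect n P x m e else 0.

Lemma dinj_subproof n (x : P n) : `[< finsupp (dinj_fun x) >].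
Proof.
apply/asboolP; exists n.+1 => m; rewrite /dinj_fun; case: eqP => // nm.
by move=> ltnm; case/negP: (negbT (ltnn m)); rewrite -[X in (X < _)%N]nm.
Qed.
Definition dinj n (x : P n) : dsum := DSum (dinj_subproof x).

Lemma dinj_id n (x : P n) : dinj_fun x n = x.
Proof. by rewrite /dinj_fun; case: eqP => // e; rewrite (eq_irrelevance e erefl). Qed.

Lemma dinj_neq n m (x : P n) : n != m -> dinj_fun x m = 0.
Proof. by rewrite /dinj_fun; case: eqP. Qed.

Definition dbound (x : dsum) : nat := sval (cid (dsum_finsupp x)).

(* The homogeneous components of [x], including all the nonzero ones. *)
Definition homparts (x : dsum) : seq {n & P n} :=
  [seq Tagged P (x n) | n <- iota 0 (dbound x)].

Lemma homparts_sum x : x = \sum_(h <- homparts x) dinj (tagged h).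
Proof.
apply: dsumP => n; rewrite big_map /=.
have -> : forall s, (\sum_(i <- s) dinj (x i)) n = \sum_(i <- s) dinj (x i) n.
  by elim=> [|i s IH]; rewrite ?big_nil ?big_cons //= -IH.
have [ltn|gen] := ltnP n (dbound x).
  rewrite (bigD1_seq n) ?mem_iota ?iota_uniq //= dinj_id.
  by rewrite big1 ?addr0 // => i neq; apply: (dinj_neq (x i)).
rewrite big_seq big1 => [|i].
  exact: (svalP (cid (dsum_finsupp x))).
rewrite mem_iota /= => lti; apply: (dinj_neq (x i)).
by rewrite neq_ltn (leq_trans lti gen).
Qed.

(* [P n] is placed in degree [n.+1], so that |x| = n on it. *)
Definition dsum_gr (z : int) (x : dsum) : Prop :=
  forall n : nat, n.+1%:Z != z -> x n = 0.

End DirectSum.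

Arguments dsum_gr {k} P.

Section OperadOperations.
Variables (k : fieldType) (O : nsOperad k).
Implicit Types (x y : {n & O n}) (xs : seq {n & O n}).

Definition tcomp x (i : nat) y : {n & O n} :=
  Tagged (opP O) (pcomp (tagged x) (inord i) (tagged y)).

(* The iterated composition $(\cdots(x\circ_{i_r}x_r)\cdots)\circ_{i_1}x_1$,
   with rightmost entries composed first. *)
Definition itcomp x (i : seq nat) xs : {n & O n} :=
  foldr (fun iy z => tcomp z iy.1 iy.2) x (zip i xs).

Definition brace_sign (i : seq nat) xs : nat :=
  let dg := [seq tag x | x <- xs] in
  (\sum_(p < size xs) nth 0 dg p * (nth 0 i p + \sum_(q < p) nth 0 dg q))%N.

Definition hbrace x xs : dsum O :=
  \sum_(i : (size xs).-tuple 'I_(tag x).+1 | sorted ltn (map val i))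
     (-1) ^+ brace_sign (map val i) xs *: dinj (tagged (itcomp x (map val i) xs)).

Fixpoint choices (T : Type) (ss : seq (seq T)) : seq (seq T) :=
  if ss is s :: ss' then [seq h :: t | h <- s, t <- choices ss'] else [:: [::]].

(* The operations are given on homogeneous elements and extended
   multilinearly. *)
Definition brace (x : dsum O) (xs : seq (dsum O)) : dsum O :=
  \sum_(h <- homparts x) \sum_(hs <- choices (map (@homparts k O) xs))
     hbrace h hs.

Variable mu : O 1%N.

Definition cup (x y : dsum O) : dsum O :=
  \sum_(h <- homparts x) \sum_(h' <- homparts y)
     (-1) ^+ (tag h).+1 *: hbrace (Tagged (opP O) mu) [:: h; h'].

Definition odiff (x : dsum O) : dsum O :=
  \sum_(h <- homparts x)
     (dinj (circ mu (tagged h)) - (-1) ^+ tag h *: dinj (circ (tagged h) mu)).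

End OperadOperations.

Section HomotopyG.
Variables (k : fieldType) (V : lmodType k).

(* [gr n x] means that [x] lies in the component V^n of V. *)
Record is_grading (gr : int -> V -> Prop) : Prop := IsGrading {
  gr_0 : forall n, gr n 0;
  gr_DZ : forall n a u v, gr n u -> gr n v -> gr n (a *: u + v);
  gr_span : forall v, exists (s : seq int) (c : int -> V),
    (forall n, gr n (c n)) /\ v = \sum_(n <- s) c n;
  gr_indep : forall (s : seq int) (c : int -> V), uniq s ->
    (forall n, gr n (c n)) -> \sum_(n <- s) c n = 0 ->
    forall n, n \in s -> c n = 0
}.

Variable gr : int -> V -> Prop.

Record homog := Homog { hcomp : int; hval :> V; _ : gr hcomp hval }.

(* For x in V^n this is |x| = n - 1. *)
Definition hdeg (x : homog) : int := hcomp x - 1.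
Definition hdegs (xs : seq homog) : int := \sum_(x <- xs) hdeg x.
Definition hvals (xs : seq homog) : seq V := [seq hval x | x <- xs].

Definition sg (e : int) : k := (-1) ^ e.

Variables (br : V -> seq V -> V) (mul : V -> V -> V) (d : V -> V).

(* y_{a+1}, ..., y_b *)
Definition slice (T : Type) (a b : nat) (ys : seq T) := take (b - a) (drop a ys).

Definition interleaved (ij : seq (nat * nat)) : bool :=
  sorted leq (flatten [seq [:: p.1; p.2] | p <- ij]).

(* The argument list y_{j+1}, ..., y_{i_1}, x_1{y_{i_1+1}, ..., y_{j_1}},
   y_{j_1+1}, ..., x_m{y_{i_m+1}, ..., y_{j_m}}, y_{j_m+1}, ..., y_n. *)
Fixpoint insert_args (j : nat) (ij : seq (nat * nat)) (xs ys : seq V) : seq V :=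
  match ij, xs with
  | (i1, j1) :: ij', x :: xs' =>
      slice j i1 ys ++ br x (slice i1 j1 ys) :: insert_args j1 ij' xs' ys
  | _, _ => drop j ys
  end.

Definition insert_sign (i : seq nat) (xs ys : seq homog) : int :=
  \sum_(xi <- zip xs i) hdeg xi.1 * hdegs (take xi.2 ys).

Record is_homotopyG : Prop := IsHomotopyG {
  hG_grading : is_grading gr;

  hG_brZl : forall xs, linear (br^~ xs);
  hG_brZr : forall x s1 s2, linear (fun y => br x (s1 ++ y :: s2));
  hG_br0 : forall x, br x [::] = x;
  hG_brdeg : forall (x : homog) (xs : seq homog),
    gr (hdeg x + hdegs xs + 1) (br x (hvals xs));
  hG_mulZl : forall y, linear (mul^~ y);
  hG_mulZr : forall x, linear (mul x);
  hG_muldeg : forall n m x y, gr n x -> gr m y -> gr (n + m) (mul x y);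
  hG_dZ : linear d;
  hG_ddeg : forall n x, gr n x -> gr (n + 1) (d x);

  hG_brace : forall (x : homog) (xs ys : seq homog),
    br (br x (hvals xs)) (hvals ys) =
    \sum_(i : (size xs).-tuple 'I_(size ys).+1)
    \sum_(j : (size xs).-tuple 'I_(size ys).+1 |
            interleaved (zip (map val i) (map val j)))
      sg (insert_sign (map val i) xs ys) *:
      br x (insert_args 0 (zip (map val i) (map val j)) (hvals xs) (hvals ys));

  hG_mulA : associative mul;
  hG_dd : forall x, d (d x) = 0;
  hG_dmul : forall x y : homog,
    d (mul x y) = mul (d x) y + sg (hdeg x + 1) *: mul x (d y);

  hG_mulbr : forall (x y : homog) (zs : seq homog),
    br (mul x y) (hvals zs) =
    \sum_(l < (size zs).+1) sg ((hdeg y + 1) * hdegs (take l zs)) *: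
      mul (br x (hvals (take l zs))) (br y (hvals (drop l zs)));

  hG_dbr : forall (x : homog) (xs : seq homog), (0 < size xs)%N ->
    let N := size xs in
    let v := hvals xs in
    let sd i := hdegs (take i xs) in
    d (br x v) - br (d x) v
    - sg (hdeg x) *: (\sum_(i < N) sg (sd i) *:
                        br x (take i v ++ d (nth 0 v i) :: drop i.+1 v))
    = sg ((hdeg x + 1) * sd 1%N) *: mul (nth 0 v 0) (br x (drop 1 v))
      + sg (hdeg x + sd N.-1) *: mul (br x (take N.-1 v)) (nth 0 v N.-1)
      - sg (hdeg x) *: (\sum_(i < N.-1) sg (sd i.+1) *:
          br x (take i v ++ mul (nth 0 v i) (nth 0 v i.+1) :: drop i.+2 v))
}.

End HomotopyG.

Section Cochains.
Variables (k : fieldType) (A : comAlgType k).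

Definition tri n := {pq : 'I_n * 'I_n | (pq.1 < pq.2)%N}.
Definition tri_row n (t : tri n) : 'I_n := (sval t).1.
Definition tri_col n (t : tri n) : 'I_n := (sval t).2.

Definition arr n := {ffun tri n -> A}.

Definition arr_upd n (T : arr n) (t : tri n) (a : A) : arr n :=
  [ffun s => if s == t then a else T s].

(* Linear maps out of the n(n-1)/2-fold tensor power of A are represented by
   the multilinear maps on arrays indexed by [tri n]. *)
Definition multilinear n (f : arr n -> A) : Prop :=
  forall (T : arr n) (t : tri n), linear (fun a => f (arr_upd T t a)).

Definition is_cochain n : {pred arr n -> A} := fun f => `[< multilinear f >].

Lemma is_cochain_submod n : submod_closed (@is_cochain n).
Proof.
split=> [|a f g /asboolP fL /asboolP gL]; apply/asboolP => T t b u v /=.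
  by rewrite scaler0 addr0.
have E x : (a *: f + g) x = a *: f x + g x by [].
by rewrite !E fL gL !scalerDr !scalerA [b * a]mulrC addrACA.
Qed.

HB.instance Definition _ n :=
  GRing.isSubmodClosed.Build k (arr n -> A) (@is_cochain n)
    (@is_cochain_submod n).

(* C^n_{S^2}(A, A) is [cochain n]. *)
Record cochain n := Cochain { cfun :> arr n -> A; _ : cfun \in @is_cochain n }.

HB.instance Definition _ n := [isSub for @cfun n].
HB.instance Definition _ n := [Choice of cochain n by <:].
HB.instance Definition _ n := [SubChoice_isSubLmodule of cochain n by <:].

Lemma cochain_multilinear n (f : cochain n) : multilinear f.
Proof. by case: f => f /= /asboolP. Qed.

(* The map pi that contracts the block i, ..., i + m to i (here [m.+1] is the
   arity inserted at input i, and indices start at 0). *)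
Definition collapse (m i p : nat) : nat :=
  if (p < i)%N then p else if (p <= i + m)%N then i else (p - m)%N.

Lemma collapseE m i p :
  (p < i)%N /\ collapse m i p = p \/ (i <= p <= i + m)%N /\ collapse m i p = i \/
  (i + m < p)%N /\ collapse m i p = (p - m)%N.
Proof. by rewrite /collapse; do ?case: ifP => ? //; lia. Qed.

Section PartialComposition.
Variables (n m : nat) (i : 'I_n.+1).

Definition arr_outer (T : arr (n + m).+1) : arr n.+1 :=
  [ffun rs => \prod_(t | (collapse m i (tri_row t) == tri_row rs)
                         && (collapse m i (tri_col t) == tri_col rs)) T t].

Lemma blk_lt (p : 'I_m.+1) : (i + p < (n + m).+1)%N.
Proof. by rewrite ltnS leq_add // -ltnS. Qed.
Definition blk (p : 'I_m.+1) : 'I_(n + m).+1 := Ordinal (blk_lt p).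

Lemma tri_blk_lt (t : tri m.+1) : (blk (tri_row t) < blk (tri_col t))%N.
Proof. by rewrite /= ltn_add2l (svalP t). Qed.
Definition tri_blk (t : tri m.+1) : tri (n + m).+1 :=
  exist _ (blk (tri_row t), blk (tri_col t)) (tri_blk_lt t).

Definition arr_inner (T : arr (n + m).+1) : arr m.+1 :=
  [ffun t => T (tri_blk t)].

Definition S2_pcomp_fun (f : cochain n.+1) (g : cochain m.+1)
    (T : arr (n + m).+1) : A :=
  f (arr_outer T) * g (arr_inner T).

Lemma outer_upd_in T t a : collapse m i (tri_row t) = collapse m i (tri_col t) ->
  arr_outer (arr_upd T t a) = arr_outer T.
Proof.
move=> ct; apply/ffunP => rs; rewrite !ffunE; apply: eq_bigr => s /andP[/eqP sr /eqP sc].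
rewrite ffunE; case: eqP => // st; move: (svalP rs); rewrite -/(tri_row _) -/(tri_col _).
by rewrite -sr -sc st ct ltnn.
Qed.

Lemma tri_eq N (s t : tri N) :
  tri_row s = tri_row t :> nat -> tri_col s = tri_col t :> nat -> s = t.
Proof.
case: s t => [[p q] s] [[p' q'] t]; rewrite /tri_row /tri_col /= => /val_inj pp /val_inj qq.
by subst p' q'; rewrite (bool_irrelevance s t).
Qed.

Lemma tri_blk_inj : injective tri_blk.
Proof.
by move=> s t st; have [rr cc] := congr1 sval st; apply: tri_eq; lia.
Qed.

Lemma inner_upd_in T t a :
  arr_inner (arr_upd T (tri_blk t) a) = arr_upd (arr_inner T) t a.
Proof. by apply/ffunP => s; rewrite !ffunE (inj_eq tri_blk_inj). Qed.

Lemma tri_lt N (t : tri N) : (tri_row t < tri_col t)%N.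
Proof. exact: (svalP t). Qed.

Lemma collapse_eq (t : tri (n + m).+1) :
  collapse m i (tri_row t) = collapse m i (tri_col t) -> exists t', t = tri_blk t'.
Proof.
have := tri_lt t; have := ltn_ord (tri_col t); rewrite /collapse => cN rc E.
have [ir cim] : (i <= tri_row t)%N /\ (tri_col t <= i + m)%N.
  by move: E; do ?case: ifP => ? //; lia.
have lr : (tri_row t - i < m.+1)%N by lia.
have lc : (tri_col t - i < m.+1)%N by lia.
have lt' : (Ordinal lr < Ordinal lc)%N by rewrite /=; lia.
exists (exist _ (Ordinal lr, Ordinal lc) lt').
by apply: tri_eq; rewrite /= ?subnKC //; lia.
Qed.

Lemma collapse_blk (p : 'I_m.+1) : collapse m i (blk p) = i.
Proof. by have := ltn_ord p; rewrite /collapse /=; do ?case: ifP => ? //; lia. Qed.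

Lemma inner_upd_out T t a : collapse m i (tri_row t) <> collapse m i (tri_col t) ->
  arr_inner (arr_upd T t a) = arr_inner T.
Proof.
move=> ct; apply/ffunP => s; rewrite !ffunE; case: eqP => // st; case: ct.
by rewrite -st !collapse_blk.
Qed.

Lemma outer_upd_out T t : collapse m i (tri_row t) <> collapse m i (tri_col t) ->
  exists rs c, forall a,
    arr_outer (arr_upd T t a) = arr_upd (arr_outer T) rs (a * c).
Proof.
move=> ct; have rc := tri_lt t; have ln := ltn_ord i.
have lr : (collapse m i (tri_row t) < n.+1)%N.
  by have := ltn_ord (tri_row t); rewrite /collapse; do ?case: ifP => ? //; lia.
have lc : (collapse m i (tri_col t) < n.+1)%N.
  by have := ltn_ord (tri_col t); rewrite /collapse; do ?case: ifP => ? //; lia.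
have lrc : (Ordinal lr < Ordinal lc)%N.
  by move: ct; rewrite /= /collapse; do ?case: ifP => ? //; lia.
exists (exist _ (Ordinal lr, Ordinal lc) lrc).
exists (\prod_(s | ((collapse m i (tri_row s) == collapse m i (tri_row t))
     && (collapse m i (tri_col s) == collapse m i (tri_col t))) && (s != t)) T s).
move=> a; apply/ffunP => rs; rewrite !ffunE; case: eqP => [->|nrs].
  rewrite (bigD1 t) /=; last by rewrite !eqxx.
  rewrite ffunE eqxx; congr (_ * _); apply: eq_bigr => s /andP[_ /negbTE st].
  by rewrite ffunE st.
apply: eq_bigr => s /andP[/eqP sr /eqP sc]; rewrite ffunE; case: eqP => // st.
by case: nrs; apply: tri_eq; rewrite /= -st.
Qed.

Lemma S2_pcomp_subproof f g : S2_pcomp_fun f g \in @is_cochain (n + m).+1.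
Proof.
apply/asboolP => T t b u v /=; rewrite /S2_pcomp_fun.
have [ct|ct] := pselect (collapse m i (tri_row t) = collapse m i (tri_col t)).
  rewrite !outer_upd_in //; have [t' ->] := collapse_eq ct.
  by rewrite !inner_upd_in cochain_multilinear mulrDr scalerAr.
rewrite !inner_upd_out //; have [rs [c E]] := outer_upd_out T ct.
by rewrite !E mulrDl -scalerAl cochain_multilinear mulrDl scalerAl.
Qed.

Definition S2_pcomp f g : cochain (n + m).+1 := Cochain (S2_pcomp_subproof f g).

End PartialComposition.

Lemma S2_op1_subproof : (fun _ : arr 1 => 1) \in @is_cochain 1.
Proof. by apply/asboolP => T t; have := tri_lt t; rewrite !ord1. Qed.
Definition S2_op1 : cochain 1 := Cochain S2_op1_subproof.

Definition agree N M (T : arr N) (S : arr M) :=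
  forall t s, tri_row t = tri_row s :> nat -> tri_col t = tri_col s :> nat ->
    T t = S s.

Lemma cochain_tagged_eq N M (f : cochain N.+1) (g : cochain M.+1) : N = M ->
  (forall T S, agree T S -> f T = g S) ->
  Tagged (fun n => cochain n.+1) f = Tagged (fun n => cochain n.+1) g.
Proof.
move=> NM; case: _ / NM g => g E; congr Tagged; apply: val_inj.
apply: functional_extensionality_dep => T; apply: E => t s rr cc.
by rewrite (tri_eq rr cc).
Qed.

Lemma agreeE N (T S : arr N) : agree T S -> T = S.
Proof. by move=> TS; apply/ffunP => t; apply: TS. Qed.

Lemma prod_agree N M (T : arr N) (S : arr M) (Q : nat -> nat -> bool) :
  N = M -> agree T S ->
  \prod_(t | Q (tri_row t) (tri_col t)) T t
  = \prod_(t | Q (tri_row t) (tri_col t)) S t.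
Proof. by move=> NM; case: _ / NM S => S /agreeE->. Qed.

Lemma prod_single N (T : arr N) (Q : nat -> nat -> bool) (t : tri N) :
  (forall p q, (p < q < N)%N ->
     Q p q = (p == tri_row t :> nat) && (q == tri_col t :> nat)) ->
  \prod_(s | Q (tri_row s) (tri_col s)) T s = T t.
Proof.
by move=> QE; rewrite (big_pred1 t) // => s; rewrite QE ?tri_lt ?ltn_ord //.
Qed.

Lemma prod_fibre N M (T : arr N) (phi : nat -> nat) (Q : nat -> nat -> bool) :
  (forall p q, (p < q < N)%N -> Q (phi p) (phi q) -> (phi p < phi q < M)%N) ->
  \prod_(t : tri M | Q (tri_row t) (tri_col t))
     \prod_(s | (phi (tri_row s) == tri_row t) && (phi (tri_col s) == tri_col t)) T s
  = \prod_(s | Q (phi (tri_row s)) (phi (tri_col s))) T s.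
Proof.
move=> Qphi.
rewrite (exchange_big_dep (fun s => Q (phi (tri_row s)) (phi (tri_col s)))) /=; last first.
  by move=> t s Qt /andP[/eqP-> /eqP->].
apply: eq_bigr => s Qs.
have /andP[lt1 lt2] : (phi (tri_row s) < phi (tri_col s) < M)%N.
  by apply: Qphi; rewrite ?tri_lt ?ltn_ord.
pose t0 : tri M := exist (fun pq : 'I_M * 'I_M => (pq.1 < pq.2)%N)
  (Ordinal (ltn_trans lt1 lt2), Ordinal lt2) lt1.
rewrite (big_pred1 t0) // => t; apply/andP/eqP => [[_ /andP[/eqP r /eqP c]]|->].
  exact: tri_eq.
by rewrite /= !eqxx.
Qed.

Lemma prod_blk n m (i : 'I_n.+1) (T : arr (n + m).+1) (Q : nat -> nat -> bool) :
  (forall p q, (p < q < (n + m).+1)%N -> Q p q -> (i <= p)%N && (q <= i + m)%N) ->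
  \prod_(s | Q (tri_row s) (tri_col s)) T s
  = \prod_(s : tri m.+1 | Q (i + tri_row s)%N (i + tri_col s)%N) T (tri_blk i s).
Proof.
move=> Qblk.
rewrite (reindex_omap (tri_blk i) (fun s => [pick t | tri_blk i t == s])); last first.
  move=> s Qs; case: pickP => [t /eqP ts|/= nt]; first by rewrite /= ts.
  have /andP[ir ci] : (i <= tri_row s)%N && (tri_col s <= i + m)%N.
    by apply: Qblk; rewrite ?tri_lt ?ltn_ord.
  have rc := tri_lt s.
  have ct : collapse m i (tri_row s) = collapse m i (tri_col s).
    by rewrite /collapse; do ?case: ifP => ? //; lia.
  by have [t st] := collapse_eq ct; move: (nt t); rewrite st eqxx.
apply: eq_bigl => s /=; case: pickP => [t /eqP/tri_blk_inj-> |/(_ s)].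
  by rewrite eqxx andbT.
by rewrite eqxx.
Qed.

Arguments prod_single [N] T Q t _.
Arguments prod_fibre [N M T] phi Q _.
Arguments prod_agree [N M] T S Q _ _.
Arguments prod_blk [n m] i T Q _.

Lemma collapse_seq m n i j p : (j <= m)%N ->
  collapse m i (collapse n (i + j) p) = collapse (m + n) i p.
Proof.
have := collapseE m i (collapse n (i + j) p); have := collapseE n (i + j) p.
by have := collapseE (m + n) i p; lia.
Qed.

Lemma collapse_par m n i j p : (i < j)%N ->
  collapse m i (collapse n (j + m) p) = collapse n j (collapse m i p).
Proof.
have := collapseE m i (collapse n (j + m) p); have := collapseE n (j + m) p.
by have := collapseE n j (collapse m i p); have := collapseE m i p; lia.
Qed.

Lemma collapse_shift n i j p : collapse n (i + j) (i + p) = (i + collapse n j p)%N.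
Proof.
by have := collapseE n (i + j) (i + p); have := collapseE n j p; lia.
Qed.

Lemma cochain_DZE n a (u v : cochain n) T : (a *: u + v) T = a *: u T + v T.
Proof. by []. Qed.

Lemma S2_pcompDZl n m (i : 'I_n.+1) (g : cochain m.+1) :
  linear (fun f : cochain n.+1 => S2_pcomp i f g).
Proof.
move=> a u v; apply: val_inj; apply: functional_extensionality_dep => T.
by rewrite /= /S2_pcomp_fun cochain_DZE mulrDl -scalerAl.
Qed.

Lemma S2_pcompDZr n m (f : cochain n.+1) (i : 'I_n.+1) :
  linear (fun g : cochain m.+1 => S2_pcomp i f g).
Proof.
move=> a u v; apply: val_inj; apply: functional_extensionality_dep => T.
by rewrite /= /S2_pcomp_fun cochain_DZE mulrDr -scalerAr.
Qed.

Lemma S2_pcompA_seq l m n (f : cochain l.+1) (g : cochain m.+1)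
    (h : cochain n.+1) (i : 'I_l.+1) (j : 'I_m.+1) :
  Tagged (fun n => cochain n.+1) (S2_pcomp (inord (i + j)) (S2_pcomp i f g) h)
  = Tagged (fun n => cochain n.+1) (S2_pcomp i f (S2_pcomp j g h)).
Proof.
have ln := ltn_ord i; have lj := ltn_ord j.
apply: cochain_tagged_eq => [|T S TS]; first by rewrite addnA.
have ij : (inord (i + j) : 'I_(l + m).+1) = (i + j)%N :> nat by rewrite inordK //; lia.
rewrite /= /S2_pcomp_fun /= /S2_pcomp_fun mulrA; congr (f _ * g _ * h _).
- apply/ffunP => rs; have := tri_lt rs; rewrite !ffunE => rc.
  under eq_bigr => t _ do rewrite ffunE.
  rewrite (prod_fibre (collapse n (inord (i + j) : 'I_(l + m).+1))
    (fun p q => (collapse m i p == tri_row rs) && (collapse m i q == tri_col rs))).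
  rewrite -(prod_agree T S (fun p q =>
    (collapse (m + n) i p == tri_row rs) && (collapse (m + n) i q == tri_col rs))) //; last by rewrite addnA.
    by apply: eq_bigl => s; rewrite ij !collapse_seq // -ltnS.
  move=> p q pq; rewrite ij => /andP[/eqP Ep /eqP Eq].
  have := collapseE m i (collapse n (i + j) p).
  have := collapseE m i (collapse n (i + j) q).
  have := collapseE n (i + j) p; have := collapseE n (i + j) q; lia.
- apply/ffunP => rs; have := tri_lt rs; rewrite !ffunE => rc.
  pose Q p q := (collapse n (inord (i + j) : 'I_(l + m).+1) p == i + tri_row rs)%N &&
     (collapse n (inord (i + j) : 'I_(l + m).+1) q == i + tri_col rs)%N.
  rewrite (prod_agree T S Q) //; last by rewrite addnA.
  rewrite (prod_blk i S Q) /Q; last first.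
    move=> p q pq; rewrite ij => /andP[/eqP Ep /eqP Eq].
    have := ltn_ord (tri_col rs); have := ltn_ord (tri_row rs).
    by move: Ep Eq; rewrite /collapse; do ?case: ifP => ? //; lia.
  under [RHS]eq_bigr => s _ do rewrite ffunE.
  by apply: eq_bigl => s; rewrite ij !collapse_shift !eqn_add2l.
- apply/ffunP => rs; rewrite !ffunE; apply: TS; rewrite /= ij; lia.
Qed.

Lemma S2_pcompA_par l m n (f : cochain l.+1) (g : cochain m.+1)
    (h : cochain n.+1) (i j : 'I_l.+1) : (i < j)%N ->
  Tagged (fun n => cochain n.+1) (S2_pcomp (inord (j + m)) (S2_pcomp i f g) h)
  = Tagged (fun n => cochain n.+1) (S2_pcomp (inord i) (S2_pcomp j f h) g).
Proof.
move=> ij; have ln := ltn_ord i; have lj := ltn_ord j.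
apply: cochain_tagged_eq => [|T S TS]; first by rewrite addnAC.
have jm : (inord (j + m) : 'I_(l + m).+1) = (j + m)%N :> nat by rewrite inordK //; lia.
have ii : (inord i : 'I_(l + n).+1) = i :> nat by rewrite inordK //; lia.
rewrite /= /S2_pcomp_fun /= /S2_pcomp_fun mulrAC; congr (f _ * h _ * g _).
- apply/ffunP => rs; have := tri_lt rs; rewrite !ffunE => rc.
  under eq_bigr => t _ do rewrite ffunE.
  under [RHS]eq_bigr => t _ do rewrite ffunE.
  rewrite (prod_fibre (collapse n (inord (j + m) : 'I_(l + m).+1))
    (fun p q => (collapse m i p == tri_row rs) && (collapse m i q == tri_col rs))); last first.
    move=> p q pq; rewrite jm => /andP[/eqP Ep /eqP Eq].
    have := collapseE m i (collapse n (j + m) p).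
    have := collapseE m i (collapse n (j + m) q).
    have := collapseE n (j + m) p; have := collapseE n (j + m) q; lia.
  rewrite (prod_fibre (collapse m (inord i : 'I_(l + n).+1))
    (fun p q => (collapse n j p == tri_row rs) && (collapse n j q == tri_col rs))); last first.
    move=> p q pq; rewrite ii => /andP[/eqP Ep /eqP Eq].
    have := collapseE n j (collapse m i p).
    have := collapseE n j (collapse m i q).
    have := collapseE m i p; have := collapseE m i q; lia.
  rewrite -(prod_agree T S (fun p q =>
    (collapse n j (collapse m (inord i : 'I_(l + n).+1) p) == tri_row rs) &&
    (collapse n j (collapse m (inord i : 'I_(l + n).+1) q) == tri_col rs))) //; last by rewrite addnAC.
  by apply: eq_bigl => s; rewrite jm ii !collapse_par.
- apply/ffunP => rs; have := tri_lt rs; rewrite !ffunE => rc.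
  pose Q p q := (collapse m (inord i : 'I_(l + n).+1) p == j + tri_row rs)%N &&
    (collapse m (inord i : 'I_(l + n).+1) q == j + tri_col rs)%N.
  rewrite -(prod_agree T S Q) //; last by rewrite addnAC.
  apply/esym/(prod_single T Q) => p q pq; rewrite /Q ii /= jm /collapse.
  by do ?case: ifP => ? //; lia.
- apply/ffunP => rs; have := tri_lt rs; rewrite !ffunE => rc.
  pose Q p q := (collapse n (inord (j + m) : 'I_(l + m).+1) p == i + tri_row rs)%N &&
    (collapse n (inord (j + m) : 'I_(l + m).+1) q == i + tri_col rs)%N.
  rewrite (prod_agree T S Q) //; last by rewrite addnAC.
  have := ltn_ord (tri_col rs).
  move=> cm; apply: (prod_single S Q) => p q pq; rewrite /Q jm /= ii /collapse.
  by do ?case: ifP => ? //; lia.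
Qed.

Lemma S2_pcomp1l n (f : cochain n.+1) :
  Tagged (fun n => cochain n.+1) (S2_pcomp ord0 S2_op1 f)
  = Tagged (fun n => cochain n.+1) f.
Proof.
apply: cochain_tagged_eq => // T S TS.
rewrite /= /S2_pcomp_fun /= mul1r; congr (f _).
by apply/ffunP => t; rewrite ffunE; apply: TS.
Qed.

Lemma S2_pcomp1r n (f : cochain n.+1) (i : 'I_n.+1) :
  Tagged (fun n => cochain n.+1) (S2_pcomp i f S2_op1)
  = Tagged (fun n => cochain n.+1) f.
Proof.
apply: cochain_tagged_eq => [|T S TS]; first by rewrite addn0.
rewrite /= /S2_pcomp_fun /= mulr1; congr (f _).
apply/ffunP => t; rewrite ffunE.
pose Q p q := (collapse 0 i p == tri_row t) && (collapse 0 i q == tri_col t).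
rewrite (prod_agree T S Q) ?addn0 //.
apply: (prod_single S Q) => p q pq; rewrite /Q /collapse.
by do ?case: ifP => ? //; lia.
Qed.

Definition S2_operad : nsOperad k :=
  @NSOperad k (fun n => cochain n.+1)
    (fun n m f i g => S2_pcomp i f g) S2_op1
    S2_pcompDZl S2_pcompDZr S2_pcompA_seq S2_pcompA_par S2_pcomp1l S2_pcomp1r.

Definition tri01 : tri 2 :=
  exist (fun pq : 'I_2 * 'I_2 => (pq.1 < pq.2)%N) (ord0, ord_max) isT.

Lemma S2_mult_subproof : (fun T : arr 2 => T tri01) \in @is_cochain 2.
Proof.
apply/asboolP => T t a u v /=; rewrite !ffunE.
suff -> : tri01 = t by rewrite eqxx.
by have tlt := tri_lt t; apply: tri_eq => /=; have := ltn_ord (tri_col t); lia.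
Qed.
Definition S2_mult : S2_operad 1%N := Cochain S2_mult_subproof.

End Cochains.

(* Main.v *)
Require Import Defs.
From mathcomp Require Import all_boot all_order all_algebra.
From mathcomp Require Import boolp zify.

(** Every non-symmetric operad with a multiplication carries a homotopy
    G-algebra structure ([multiplicative_operad_homotopyG]); the operad of the
    statement enters only through the equation mu o mu = 0. There, both partial
    compositions of mu with itself send a triangular array to the product of
    its three entries, because the algebra is commutative, and they occur in
    mu o mu with opposite signs.

    The heart is axiom (a), the expansion of x{x_1, .., x_m}{y_1, .., y_n}. A
    brace is a sum over the ways to plug its arguments, in order, into the
    inputs (slots) of x. Reading the slots from left to right gives a recursion
    ([slot_brace]): the next slot stays empty or takes the first argument that
    is left. With it, (a) is an induction on the slots of x
    ([slot_brace_slot_brace]). If the next slot is empty, it is a slot of the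
    composite, which stays empty or takes y_1. If it takes x_1, it becomes
    |x_1| + 1 slots, and these take an initial segment y_1, .., y_l of the y's
    and so form x_1{y_1, .., y_l}, while the rest goes further to the right
    ([slot_brace_split]). The axioms of partial compositions are used only in
    this last step. The right-hand side of (a) obeys the same recursion
    ([isum_cons]). As for signs, an argument z of degree |z| always contributes
    |z| times the number of inputs on its left in the final composite; passing
    from one side of (a) to the other changes this number for x_p only, by the
    total degree of the y's placed to the left of x_p.

    The other axioms follow from (a), from mu{mu} = 0 and from the vanishing of
    mu{z_1, .., z_r} for r > 2. Axiom (c) is (a) for mu{x, y}{z_1, .., z_n}.
    Associativity, the derivation rule and d^2 = 0 come from expanding
    0 = mu{mu}{y_1, .., y_n} for n = 3, 2, 1. Axiom (d) compares the expansions of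
    x{x_1, .., x_N}{mu}, mu{x}{x_1, .., x_N} and x{mu}{x_1, .., x_N}: the terms
    with mu as an argument of x cancel, those with mu{x_i} and x_i{mu} form
    d x_i, and those with mu{x_i, x_(i+1)}, mu{x_1, _} and mu{_, x_N} are the
    products.

    Two composites of the same arity may lie in components whose indices agree
    only after rewriting. All identities are therefore stated in the direct
    sum, and both sides being multilinear, for homogeneous elements. These are
    dependent pairs [h] with degree [tag h] and image [emb h] in the sum. *)

Set Implicit Arguments.
Unset Strict Implicit.
Unset Printing Implicit Defensive.

Import Order.TTheory GRing.Theory Num.Theory.
Local Open Scope ring_scope.

(** * Signs and linear maps *)
Lemma sign_odd (R : nzRingType) (m n : nat) : odd m = odd n -> (-1) ^+ m = (-1) ^+ n :> R.
Proof. by move=> E; rewrite -signr_odd E signr_odd. Qed.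

(** Equality of two signs whose exponents are polynomial expressions, by
    comparing parities for all parities of the atoms. *)
Ltac sign_eq :=
  apply: sign_odd; rewrite /= ?(oddD, oddM, oddS) /=;
  repeat match goal with |- context [odd ?n] => case: (odd n) end; by [].

Lemma signZ (k : fieldType) (W : lmodType k) a b (w : W) :
  (-1) ^+ a *: ((-1) ^+ b *: w) = (-1) ^+ (a + b) *: w.
Proof. by rewrite scalerA exprD. Qed.

Lemma signN (k : fieldType) (W : lmodType k) (w : W) : - w = (-1) ^+ 1 *: w.
Proof. by rewrite expr1 scaleN1r. Qed.

Section Linear.
Variables (k : fieldType) (U W : lmodType k) (f : U -> W).
Hypothesis fL : linear f.

Lemma lin0 : f 0 = 0.
Proof. by have := fL (-1) 0 0; rewrite scaler0 addr0 scaleN1r addNr. Qed.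
Lemma linD x y : f (x + y) = f x + f y.
Proof. by have := fL 1 x y; rewrite !scale1r. Qed.
Lemma linZ a x : f (a *: x) = a *: f x.
Proof. by have := fL a x 0; rewrite !addr0 lin0 addr0. Qed.
Lemma linB x y : f (x - y) = f x - f y.
Proof. by rewrite linD -[- y]scaleN1r linZ scaleN1r. Qed.
Lemma lin_sum (I : Type) (r : seq I) (P : pred I) F :
  f (\sum_(i <- r | P i) F i) = \sum_(i <- r | P i) f (F i).
Proof. by apply: (big_morph f linD lin0). Qed.
End Linear.

Lemma lin_bigsum (k : fieldType) (U W : lmodType k) (I : Type) (r : seq I)
    (F : I -> U -> W) :
  (forall i, linear (F i)) -> linear (fun u => \sum_(i <- r) F i u).
Proof.
move=> FL a u w; rewrite scaler_sumr -big_split /=.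
by apply: eq_bigr => i _; rewrite FL.
Qed.

Arguments lin_bigsum {k U W I} r F.

(** * Homogeneous elements of a direct sum *)

Section Homogeneous.
Variables (k : fieldType) (P : nat -> lmodType k).
Implicit Types (x y : dsum P) (h : {n & P n}).

Definition emb h : dsum P := dinj (tagged h).

Lemma dcompD x y n : (x + y) n = x n + y n. Proof. by []. Qed.
Lemma dcompZ a x n : (a *: x) n = a *: x n. Proof. by []. Qed.

Lemma dcomp_linear n : linear (fun x => x n).
Proof. by []. Qed.

Lemma emb_linear n : linear (fun u : P n => emb (Tagged P u)).
Proof.
move=> a u w; apply: dsumP => m; rewrite dcompD dcompZ /= /dinj_fun.
by case: eqP => [e|_]; [case: m / e | rewrite scaler0 addr0].
Qed.

Lemma emb_comp h : emb h (tag h) = tagged h. Proof. exact: dinj_id. Qed.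
Lemma emb_neq h n : tag h != n -> emb h n = 0. Proof. exact: dinj_neq. Qed.

(** Lets identities that are linear in an argument be checked on homogeneous
    elements. *)
Lemma dsum_ind (Q : dsum P -> Prop) :
  Q 0 -> (forall x y, Q x -> Q y -> Q (x + y)) -> (forall h, Q (emb h)) -> forall x, Q x.
Proof.
move=> Q0 QD Qi x; rewrite (homparts_sum x).
by apply: big_ind => // h _; apply: Qi.
Qed.

Section Extension.
Variables (W : lmodType k) (f : {n & P n} -> W).
Hypothesis fL : forall n, linear (fun u : P n => f (Tagged P u)).

(** The list of homogeneous parts ends at a chosen bound of the support; as
    [f] kills zero components, any other bound gives the same sum. This is what
    makes extensions by linearity additive. *)
Lemma homparts_bound x M : (forall n, (M <= n)%N -> x n = 0) ->
  \sum_(h <- homparts x) f h = \sum_(0 <= n < M) f (Tagged P (x n)).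
Proof.
move=> xM; rewrite big_map; pose B := dbound x.
have xB n : (B <= n)%N -> x n = 0 by exact: (svalP (cid (dsum_finsupp x))).
have E N K : (N <= K)%N -> (forall n, (N <= n)%N -> x n = 0) ->
    \sum_(0 <= n < K) f (Tagged P (x n)) = \sum_(0 <= n < N) f (Tagged P (x n)).
  move=> NK xN; rewrite (big_cat_nat _ NK) //=.
  rewrite [X in _ + X]big_nat [X in _ + X]big1 ?addr0 //.
  by move=> n /andP[Nn _]; rewrite xN // (lin0 (@fL n)).
have -> : iota 0 (dbound x) = index_iota 0 B by rewrite /index_iota subn0.
by rewrite -(E B (maxn B M)) ?leq_maxl // (E M) ?leq_maxr.
Qed.

Lemma homparts_linear : linear (fun x => \sum_(h <- homparts x) f h).
Proof.
move=> a x y; pose M := maxn (dbound (a *: x + y)) (maxn (dbound x) (dbound y)).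
have B z n : (dbound z <= n)%N -> z n = 0 by exact: (svalP (cid (dsum_finsupp z))).
rewrite !(@homparts_bound _ M);
  do ?by move=> n; rewrite !geq_max => /and3P[? ? ?]; apply: B.
by rewrite scaler_sumr -big_split; apply: eq_bigr => n _; rewrite /= fL.
Qed.

Lemma homparts_emb h : \sum_(h' <- homparts (emb h)) f h' = f h.
Proof.
case: h => n u; rewrite (@homparts_bound _ n.+1); last first.
  by move=> m nm; rewrite emb_neq //= ltn_eqF.
rewrite big_nat_recr //= big_nat big1 ?add0r; last first.
  by move=> m /andP[_ mn]; rewrite dinj_neq ?(lin0 (@fL m)) // gtn_eqF.
by rewrite dinj_id.
Qed.

End Extension.
End Homogeneous.

Arguments emb {k P}.

(** * Partial compositions on the direct sum *)

Section PartialCompositions.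
Variables (k : fieldType) (O : nsOperad k).
Local Notation V := (dsum O).
Local Notation T := {n & O n}.
Implicit Types (x y z : V) (h : T) (xs ys : seq T).

(** The condition on [i] makes composition at a missing input zero. Without it
    [i] would be replaced by another input, and the two laws below would
    need bounds on the degree of [x]. *)
Definition comp_at i x y : V :=
  \sum_(h <- homparts x) \sum_(h' <- homparts y)
     if (i <= tag h)%N then emb (tcomp h i h') else 0.

Let comp_at_hom i h h' : V := if (i <= tag h)%N then emb (tcomp h i h') else 0.

Lemma comp_at_hom_linl i n h' : linear (fun u : O n => comp_at_hom i (Tagged (opP O) u) h').
Proof.
move=> a u w; rewrite /comp_at_hom /=; case: ifP => _; last by rewrite scaler0 addr0.
by rewrite /tcomp pcompDZl emb_linear.
Qed.

Lemma comp_at_hom_linr i n h : linear (fun u : O n => comp_at_hom i h (Tagged (opP O) u)).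
Proof.
move=> a u w; rewrite /comp_at_hom /=; case: ifP => _; last by rewrite scaler0 addr0.
by rewrite /tcomp pcompDZr emb_linear.
Qed.

Lemma comp_at_linl i y : linear (fun x => comp_at i x y).
Proof.
apply: homparts_linear => n a u w;
  apply: (lin_bigsum _ (fun h' u => comp_at_hom i (Tagged (opP O) u) h')).
by move=> h'; apply: comp_at_hom_linl.
Qed.

Lemma comp_at_linr i x : linear (comp_at i x).
Proof.
apply: (lin_bigsum _ (fun h y => \sum_(h' <- homparts y) comp_at_hom i h h')) => h.
by apply: homparts_linear => n; apply: comp_at_hom_linr.
Qed.

Lemma comp_atE i h h' :
  comp_at i (emb h) (emb h') = if (i <= tag h)%N then emb (tcomp h i h') else 0.
Proof.
rewrite /comp_at (@homparts_emb _ _ _ (fun h =>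
  \sum_(h' <- homparts (emb h')) comp_at_hom i h h')).
  by rewrite (@homparts_emb _ _ _ (comp_at_hom i h)) // => n; apply: comp_at_hom_linr.
by move=> n; apply: lin_bigsum => h''; apply: comp_at_hom_linl.
Qed.

Lemma comp_at0l i y : comp_at i 0 y = 0. Proof. exact: (lin0 (comp_at_linl i y)). Qed.
Lemma comp_at0r i x : comp_at i x 0 = 0. Proof. exact: (lin0 (comp_at_linr i x)). Qed.
Lemma comp_atDl i x y z : comp_at i (x + y) z = comp_at i x z + comp_at i y z.
Proof. exact: (linD (comp_at_linl i z)). Qed.
Lemma comp_atDr i x y z : comp_at i x (y + z) = comp_at i x y + comp_at i x z.
Proof. exact: (linD (comp_at_linr i x)). Qed.
Lemma comp_atZl i a x y : comp_at i (a *: x) y = a *: comp_at i x y.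
Proof. exact: (linZ (comp_at_linl i y)). Qed.
Lemma comp_atZr i a x y : comp_at i x (a *: y) = a *: comp_at i x y.
Proof. exact: (linZ (comp_at_linr i x)). Qed.

Lemma comp_at_seq i j x h z : (j <= tag h)%N ->
  comp_at (i + j) (comp_at i x (emb h)) z = comp_at i x (comp_at j (emb h) z).
Proof.
move=> jh; elim/dsum_ind: x => [|x y Ex Ey|x]; rewrite ?comp_at0l ?comp_atDl ?Ex ?Ey //.
elim/dsum_ind: z => [|z t Ez Et|z]; rewrite ?comp_at0r ?comp_atDr ?Ez ?Et //.
rewrite !comp_atE jh; case: ifP => ix; rewrite ?comp_atE ?comp_at0l ix //=.
rewrite leq_add //; congr emb; rewrite /tcomp /=.
by rewrite -pcompA_seq !inordK.
Qed.

(** Input [j] of [x], to the right of [i], is input [j + tag h] once [h] fills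
    input [i]. *)
Lemma comp_at_par i j x h z : (i < j)%N ->
  comp_at (j + tag h) (comp_at i x (emb h)) z = comp_at i (comp_at j x z) (emb h).
Proof.
move=> ij; elim/dsum_ind: x => [|x y Ex Ey|x];
  rewrite ?comp_at0l ?comp_atDl ?Ex ?Ey ?comp_at0l //.
elim/dsum_ind: z => [|z t Ez Et|z];
  rewrite ?comp_at0r ?comp_atDr ?Ez ?Et ?comp_at0l ?comp_atDl //.
rewrite !comp_atE; have [jx|jx] := leqP j (tag x); last first.
  by rewrite comp_at0l; case: ifP => ix;
    rewrite ?comp_atE ?comp_at0l //= leq_add2r leqNgt jx.
have ix : (i <= tag x)%N by apply: leq_trans jx; apply: ltnW.
rewrite ix !comp_atE /= leq_add2r jx (leq_trans ix (leq_addr _ _)).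
congr emb; rewrite /tcomp /= -[in RHS](@inordK (tag x) i) // -pcompA_par ?inordK //.
Qed.

End PartialCompositions.

(** * Braces by recursion on the slots *)

Section SlotBraces.
Variables (k : fieldType) (O : nsOperad k).
Local Notation V := (dsum O).
Local Notation T := {n & O n}.
Implicit Types (x y z : V) (h : T) (xs ys : seq T).

(** Stating homogeneity as an equation lets it be used by rewriting [x] into the
    image of a pair. *)
Definition homdeg d x := x = emb (Tagged (opP O) (x d)).

Lemma hom_emb h : homdeg (tag h) (emb h).
Proof. by rewrite /homdeg (emb_comp h); case: h. Qed.

Lemma homDZ d a x y : homdeg d x -> homdeg d y -> homdeg d (a *: x + y).
Proof.
move=> xd yd; have := @emb_linear _ O d a (x d) (y d).
by rewrite -xd -yd; apply: esym.
Qed.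

Lemma hom0 d : homdeg d 0.
Proof.
have := homDZ (-1) (hom_emb (Tagged (opP O) (0 : O d))) (hom_emb _).
by rewrite scaleN1r addNr.
Qed.

Lemma homD d x y : homdeg d x -> homdeg d y -> homdeg d (x + y).
Proof. by move=> xd yd; rewrite -[x]scale1r; apply: homDZ. Qed.

Lemma homZ d a x : homdeg d x -> homdeg d (a *: x).
Proof. by move=> xd; rewrite -[_ *: _]addr0; apply: homDZ => //; apply: hom0. Qed.

Lemma hom_comp_at i d e x y : homdeg d x -> homdeg e y -> homdeg (d + e) (comp_at i x y).
Proof.
move=> -> ->; rewrite comp_atE; case: ifP => _; last exact: hom0.
exact: (hom_emb (tcomp _ _ _)).
Qed.

Lemma comp_at_seq_hom i j x y z d : homdeg d y -> (j <= d)%N ->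
  comp_at (i + j) (comp_at i x y) z = comp_at i x (comp_at j y z).
Proof. by move=> -> jd; apply: comp_at_seq. Qed.

Definition deg xs := sumn [seq tag h | h <- xs].

Lemma deg_split l xs : deg xs = (deg (take l xs) + deg (drop l xs))%N.
Proof. by rewrite /deg -{1}(cat_take_drop l xs) map_cat sumn_cat. Qed.

Lemma deg_cat (s1 s2 : seq T) : deg (s1 ++ s2) = (deg s1 + deg s2)%N.
Proof. by rewrite /deg map_cat sumn_cat. Qed.

Lemma deg_cons h xs : deg (h :: xs) = (tag h + deg xs)%N. Proof. by []. Qed.

Lemma deg_takeS (y : T) xs l : (l < size xs)%N ->
  deg (take l.+1 xs) = (deg (take l xs) + tag (nth y xs l))%N.
Proof. by move=> lx; rewrite (take_nth y lx) -cats1 deg_cat deg_cons addn0. Qed.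

(** The brace x{ys} restricted to the [n] slots that start at slot [a]. In the
    second summand slot [a] takes [y]: the other arguments sit to its right, so
    that they are composed first and each has [tag y] more inputs on its left
    than in the restricted brace. This shift and the [a] inputs to the left of
    [y] give the sign. *)
Fixpoint slot_brace x (a n : nat) ys : V :=
  match n, ys with
  | _, [::] => x
  | 0, _ => 0
  | n'.+1, y :: ys' =>
      slot_brace x a.+1 n' ys
      + (-1) ^+ (tag y * (a + deg ys')) *: comp_at a (slot_brace x a.+1 n' ys') (emb y)
  end.

Lemma slot_brace_nil x a n : slot_brace x a n [::] = x. Proof. by case: n. Qed.

Lemma slot_brace_linear a n ys : linear (fun x => slot_brace x a n ys).
Proof.
elim: n ys a => [|n IH] [|y ys] a b u w //=; first by rewrite scaler0 addr0.
by rewrite !IH comp_at_linl !scalerDr !scalerA [b * _]mulrC addrACA.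
Qed.

Lemma hom_slot_brace x a n ys d : homdeg d x -> homdeg (d + deg ys) (slot_brace x a n ys).
Proof.
move=> xd; elim: n ys a => [|n IH] [|y ys] a /=; rewrite ?addn0 //; first exact: hom0.
apply: homD; first exact: IH.
by apply: homZ; rewrite addnA addnAC; apply: hom_comp_at; [apply: IH | apply: hom_emb].
Qed.

(** Slots to the right of [a] are not affected by [h], except for the shift by
    its degree, which each element of [ys] feels in its sign. *)
Lemma slot_brace_par x h a b n ys : (a < b)%N ->
  slot_brace (comp_at a x (emb h)) (b + tag h) n ys
  = (-1) ^+ (tag h * deg ys) *: comp_at a (slot_brace x b n ys) (emb h).
Proof.
elim: n ys b => [|n IH] [|y ys] b ab; rewrite ?muln0 ?scale1r //=.
  by rewrite comp_at0l scaler0.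
rewrite -addSn !IH ?(leq_trans ab) // comp_atDl !scalerDr; congr (_ + _).
rewrite !comp_atZl comp_at_par // !scalerA; congr (_ *: _); rewrite -!exprD; sign_eq.
Qed.

(** Of the slots considered, the first [c] belong to [h] (they are its slots from
    [j] on) and the last [n] to [x]. As arguments are placed in order, an initial
    segment [take l ys] goes into [h]. The sign records that the elements of
    [drop l ys] gain [tag h + deg (take l ys)] inputs on their left, and those of
    [take l ys] gain the [a] inputs of [x]. *)
Lemma slot_brace_split x h a j c n ys : (j + c = (tag h).+1)%N ->
  slot_brace (comp_at a x (emb h)) (a + j) (c + n) ys =
  \sum_(l < (size ys).+1)
     (-1) ^+ (deg (drop l ys) * (tag h + deg (take l ys)) + deg (take l ys) * a)
     *: comp_at a (slot_brace x a.+1 n (drop l ys)) (slot_brace (emb h) j c (take l ys)).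
Proof.
elim: c j ys => [|c IH] j [|y ys] jc.
- by rewrite big_ord_recl big_ord0 /= !slot_brace_nil scale1r addr0.
- rewrite big_ord_recl big1 ?addr0 => [|l _]; last by rewrite comp_at0r scaler0.
  rewrite addn0 in jc; rewrite jc add0n addnS -addSn slot_brace_par //=.
  congr (_ *: _); sign_eq.
- by rewrite big_ord_recl big_ord0 /= !slot_brace_nil scale1r addr0.
have jh : (j <= tag h)%N by lia.
have jc' : (j.+1 + c = (tag h).+1)%N by rewrite addSnnS.
rewrite addSn [LHS]/= -addnS !(IH _ _ jc').
rewrite big_ord_recl [RHS]big_ord_recl -addrA; congr (_ + _).
  by rewrite !slot_brace_nil.
rewrite (lin_sum (comp_at_linl _ _)) scaler_sumr -big_split; apply: eq_bigr => l _.
rewrite /= comp_atZl comp_atDr scalerDr; congr (_ + _).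
have homY : homdeg (tag h + deg (take l ys)) (slot_brace (emb h) j.+1 c (take l ys)).
  exact/hom_slot_brace/hom_emb.
rewrite (comp_at_seq_hom _ _ _ homY) ?(leq_trans jh) ?leq_addr //.
rewrite !comp_atZr !scalerA; congr (_ *: _); rewrite -!exprD (deg_split l ys); sign_eq.
Qed.

(** A brace with homogeneous entries, again as a dependent pair, so that it can
    itself be an argument of a brace. *)
Definition tbrace h xs : T :=
  Tagged (opP O) (slot_brace (emb h) 0 (tag h).+1 xs (tag h + deg xs)%N).

Lemma tag_tbrace h xs : tag (tbrace h xs) = (tag h + deg xs)%N. Proof. by []. Qed.

Lemma emb_tbrace h xs : emb (tbrace h xs) = slot_brace (emb h) 0 (tag h).+1 xs.
Proof. by have := hom_slot_brace 0 (tag h).+1 xs (hom_emb h); rewrite /homdeg => <-. Qed.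

(** The argument lists on the right-hand side of axiom (a), with the exponents
    of their signs. They are produced from the left: either the first [x] takes
    an initial segment of [ys], which the later elements of [xs] then have on
    their left, or the first [y] stands alone to the left of all of [xs]. *)
Fixpoint insertions (xs ys : seq T) : seq (nat * seq T) :=
  if xs is x :: xs' then
    (fix ins ys :=
      flatten [seq [seq (deg (take l ys) * deg xs' + p.1, tbrace x (take l ys) :: p.2)%N
                     | p <- insertions xs' (drop l ys)]
                | l <- iota 0 (size ys).+1]
      ++ (if ys is y :: ys' then
            [seq (tag y * deg xs + p.1, y :: p.2)%N | p <- ins ys']
          else [::])) ys
  else [:: (0%N, ys)].

Section InsertionSum.
Variable W : lmodType k.
Implicit Type F : seq T -> W.

Definition isum F xs ys : W := \sum_(p <- insertions xs ys) (-1) ^+ p.1 *: F p.2.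

Lemma isum_nil F ys : isum F [::] ys = F ys.
Proof. by rewrite /isum big_seq1 scale1r. Qed.

(** The recursion that [slot_brace_slot_brace] follows on the other side of
    axiom (a). *)
Lemma isum_cons F (x : T) xs ys : isum F (x :: xs) ys =
  \sum_(l < (size ys).+1) (-1) ^+ (deg (take l ys) * deg xs)
      *: isum (fun t => F (tbrace x (take l ys) :: t)) xs (drop l ys)
  + (if ys is y :: ys' then
       (-1) ^+ (tag y * deg (x :: xs)) *: isum (fun t => F (y :: t)) (x :: xs) ys'
     else 0).
Proof.
have E e (g : seq T -> seq T) s :
    \sum_(p <- [seq (e + p.1, g p.2)%N | p <- s]) (-1) ^+ p.1 *: F p.2
    = (-1) ^+ e *: \sum_(p <- s) (-1) ^+ p.1 *: F (g p.2).
  rewrite big_map scaler_sumr; apply: eq_bigr => p _.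
  by rewrite exprD scalerA.
rewrite {1}/isum; have -> : insertions (x :: xs) ys =
  flatten [seq [seq (deg (take l ys) * deg xs + p.1, tbrace x (take l ys) :: p.2)%N
                     | p <- insertions xs (drop l ys)]
                | l <- iota 0 (size ys).+1]
      ++ (if ys is y :: ys' then
            [seq (tag y * deg (x :: xs) + p.1, y :: p.2)%N | p <- insertions (x :: xs) ys']
          else [::]) by case: ys.
rewrite big_cat big_flatten big_map; congr (_ + _).
  have -> : iota 0 (size ys).+1 = index_iota 0 (size ys).+1 by rewrite /index_iota subn0.
  rewrite big_mkord.
  by apply: eq_bigr => l _; rewrite E.
by case: ys => [|y ys']; rewrite ?big_nil // E.
Qed.

Lemma eq_isum F G xs ys : F =1 G -> isum F xs ys = isum G xs ys.
Proof. by move=> FG; apply: eq_bigr => p _; rewrite FG. Qed.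

Lemma isum_lin a F G xs ys :
  isum (fun t => a *: F t + G t) xs ys = a *: isum F xs ys + isum G xs ys.
Proof.
rewrite scaler_sumr -big_split; apply: eq_bigr => p _.
by rewrite /= scalerDr !scalerA mulrC.
Qed.

(** An argument list contains at least one entry for each element of [xs]. *)
Lemma isum0 F xs ys : (forall t, (size xs <= size t)%N -> F t = 0) -> isum F xs ys = 0.
Proof.
elim: xs F ys => [|x xs IHx] F ys; first by move=> F0; rewrite isum_nil F0.
elim: ys F => [|y ys IHy] F F0; rewrite isum_cons.
  by rewrite big1 ?addr0 // => l _; rewrite IHx ?scaler0 // => t; apply: (F0 (_ :: t)).
rewrite IHy ?scaler0 ?addr0 => [|t /= xt]; last by apply: F0; rewrite ltnW.
by rewrite big1 // => l _; rewrite IHx ?scaler0 // => t; apply: (F0 (_ :: t)).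
Qed.

(** All argument lists have the same total degree, so that signs that depend
    on it are constant along the sum. *)
Lemma eq_isum_deg F G xs ys :
  (forall t, deg t = (deg xs + deg ys)%N -> F t = G t) -> isum F xs ys = isum G xs ys.
Proof.
elim: xs F G ys => [|x xs IHx] F G ys; first by move=> FG; rewrite !isum_nil FG.
elim: ys F G => [|y ys IHy] F G FG; rewrite isum_cons [RHS]isum_cons; congr (_ + _).
- apply: eq_bigr => l _; congr (_ *: _); apply: IHx => t dt; apply: FG.
  by rewrite !deg_cons dt tag_tbrace [in RHS](deg_split l [::]); lia.
- apply: eq_bigr => l _; congr (_ *: _); apply: IHx => t dt; apply: FG.
  by rewrite deg_cons dt tag_tbrace deg_cons [in RHS](deg_split l (y :: ys)); lia.
- congr (_ *: _); apply: IHy => t dt; apply: FG.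
  by rewrite !deg_cons dt deg_cons; lia.
Qed.

End InsertionSum.

Lemma isum_comp (W1 W2 : lmodType k) (f : W1 -> W2) F xs ys : linear f ->
  f (isum F xs ys) = isum (fun t => f (F t)) xs ys.
Proof.
by move=> fL; rewrite (lin_sum fL); apply: eq_bigr => p _; rewrite (linZ fL).
Qed.

(** Axiom (a), slot by slot. The slots of [x] from [a] to [a + n - 1] that are
    available for [xs] become the [n + deg xs] slots available for [ys]. *)
Lemma slot_brace_slot_brace x a n xs ys :
  slot_brace (slot_brace x a n xs) a (n + deg xs) ys = isum (slot_brace x a n) xs ys.
Proof.
elim: n a xs ys => [|n IH] a [|x1 xs] ys; rewrite ?isum_nil ?slot_brace_nil ?addn0 //.
  by rewrite isum0 //= ?(lin0 (@slot_brace_linear _ _ _)) // => -[|].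
rewrite [slot_brace x a n.+1 _]/=.
rewrite (linD (@slot_brace_linear _ _ _)) (linZ (@slot_brace_linear _ _ _)).
have jc : (0 + (tag x1).+1 = (tag x1).+1)%N by [].
(* If slot [a] takes [x1], the [ys] split between [x1] and the slots beyond. *)
have -> : slot_brace (comp_at a (slot_brace x a.+1 n xs) (emb x1)) a
      (n.+1 + deg (x1 :: xs)) ys =
  \sum_(l < (size ys).+1)
    (-1) ^+ (deg (drop l ys) * (tag x1 + deg (take l ys)) + deg (take l ys) * a) *:
    isum (fun t => comp_at a (slot_brace x a.+1 n t) (emb (tbrace x1 (take l ys))))
      xs (drop l ys).
  have -> : (n.+1 + deg (x1 :: xs) = (tag x1).+1 + (n + deg xs))%N by rewrite /deg /=; lia.
  rewrite -[in X in slot_brace _ X](addn0 a) (slot_brace_split _ _ _ _ jc).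
  apply: eq_bigr => l _; rewrite IH -emb_tbrace.
  by rewrite (isum_comp (fun t => slot_brace x a.+1 n t) _ _ (@comp_at_linl _ _ _ _)).
have E h m t : deg t = m -> slot_brace x a n.+1 (h :: t) =
    (-1) ^+ (tag h * (a + m)) *: comp_at a (slot_brace x a.+1 n t) (emb h) +
      slot_brace x a.+1 n (h :: t).
  by move=> <-; rewrite addrC.
rewrite isum_cons.
under [in RHS]eq_bigr => l _.
  rewrite (eq_isum_deg (E _ _)) isum_lin scalerDr.
  over.
rewrite big_split -addrA addrC; congr (_ + _); last first.
  rewrite scaler_sumr; apply: eq_bigr => l _.
  rewrite !scalerA; congr (_ *: _); rewrite -!exprD tag_tbrace; sign_eq.
case: ys => [|y ys].
  by rewrite slot_brace_nil -[LHS](slot_brace_nil _ a.+1 (n + deg (x1 :: xs))) IH isum_cons.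
rewrite (eq_isum_deg (E _ _)) isum_lin scalerDr [X in _ + X]addrC addrA.
rewrite -isum_cons -!IH addSn [LHS]/=; congr (_ + _).
rewrite IH (isum_comp (fun t => slot_brace x a.+1 n t) _ _ (@comp_at_linl _ _ _ _)).
by rewrite !scalerA; congr (_ *: _); rewrite -!exprD; sign_eq.
Qed.

End SlotBraces.

(** * The operadic braces *)

(** The increasing sequences of [r] numbers in the interval from [a] to
    [a + n - 1], listed by the choice made at [a], as in the recursion for
    slots. *)
Fixpoint incseqs (a n r : nat) : seq (seq nat) :=
  match n, r with
  | _, 0 => [:: [::]]
  | 0, _ => [::]
  | n'.+1, r'.+1 => incseqs a.+1 n' r ++ map (cons a) (incseqs a.+1 n' r')
  end.

Lemma mem_incseqs a n r s : (s \in incseqs a n r) =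
  [&& size s == r, sorted ltn s & all (fun i => a <= i < a + n)%N s].
Proof.
elim: n a r s => [|n IH] a [|r] s /=.
- by rewrite inE; case: s.
- rewrite in_nil; apply/esym/negP; case: s => [|b s] //= /and3P[_ _ /andP[/andP[]]].
  by rewrite addn0 leqNgt => /negP.
- by rewrite inE; case: s.
rewrite mem_cat IH; case: s => [|b s] /=.
  by apply/negP => /mapP[].
rewrite (_ : (_ \in map _ _) = (b == a) && (s \in incseqs a.+1 n r)); last first.
  apply/mapP/andP => [[t ti [-> ->]]|[/eqP-> si]]; first by rewrite eqxx.
  by exists s.
rewrite IH eqSS (path_sortedE ltn_trans).
apply/orP/and3P => [[/and3P[sr ss /andP[bn sn]]|/andP[/eqP-> /and3P[sr ss sn]]]|].
- split=> //; apply/andP; split; first lia.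
  by apply: sub_all sn => i; lia.
- split=> //; first by rewrite ss andbT; apply: sub_all sn => i /andP[].
  by apply/andP; split; [lia | apply: sub_all sn => i; lia].
move=> [sr /andP[bs ss] /andP[bn sn]].
have sn' : all (fun i => b < i < a + n.+1)%N s.
  by apply/allP => i si; rewrite (allP bs i si); have /andP[_ ->] := allP sn i si.
have [/eqP ab|ab] := boolP (b == a); [right | left].
  by rewrite sr ss; apply: sub_all sn' => i; lia.
rewrite sr ss bs /=; apply/andP; split; first lia.
by apply: sub_all sn' => i; lia.
Qed.

Lemma incseqs_uniq a n r : uniq (incseqs a n r).
Proof.
elim: n a r => [|n IH] a [|r] //=.
rewrite cat_uniq IH map_inj_uniq ?IH => [|s t []] //; rewrite andbT /=.
apply/hasPn => s /mapP[t _ ->]; rewrite mem_incseqs /=; apply/negP.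
by move=> /and3P[_ _ /andP[/andP[]]]; rewrite ltnn.
Qed.

Lemma sum_sorted_tuples (W : nmodType) (G : seq nat -> W) N r :
  \sum_(i : r.-tuple 'I_N | sorted ltn (map val i)) G (map val i)
  = \sum_(s <- incseqs 0 N r) G s.
Proof.
rewrite -(big_map (fun i : r.-tuple 'I_N => map val i) (sorted ltn) G).
rewrite -big_filter; apply: perm_big; apply: uniq_perm; rewrite ?incseqs_uniq //.
  apply/filter_uniq; rewrite map_inj_uniq ?index_enum_uniq // => i j ij.
  by apply: val_inj; apply: (inj_map val_inj).
move=> s; rewrite mem_filter mem_incseqs; apply/andP/and3P => [[ss /mapP[i _ si]]|].
  rewrite si size_map size_tuple -si ss; split=> //.
  by rewrite si all_map; apply/allP => j _ /=; exact: ltn_ord.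
move=> [/eqP sr ss /allP sN]; split=> //; subst r.
have sN' : all (fun i => i < N)%N s by apply/allP => i /sN.
have E : map val (pmap (insub : nat -> option 'I_N) s) = s.
  by rewrite (pmap_filter (@insubK _ _ _)); apply/all_filterP; apply: sub_all sN' => i;
    rewrite isSome_insub.
have sz : size (pmap (insub : nat -> option 'I_N) s) == size s by rewrite -{2}E size_map.
by apply/mapP; exists (Tuple sz); rewrite ?mem_index_enum.
Qed.

Section OperadicBraces.
Variables (k : fieldType) (O : nsOperad k).
Local Notation V := (dsum O).
Local Notation T := {n & O n}.
Implicit Types (x y z : V) (h : T) (xs ys : seq T).

Lemma brace_sign_cons i (s : seq nat) h xs :
  brace_sign (i :: s) (h :: xs) = (tag h * i + tag h * deg xs + brace_sign s xs)%N.
Proof.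
rewrite /brace_sign /= big_ord_recl /= big_ord0 addn0 -addnA; congr (_ + _)%N.
have -> : deg xs = (\sum_(p < size xs) nth 0 [seq tag h | h <- xs] p)%N.
  by rewrite /deg sumnE (big_nth 0%N) size_map big_mkord.
rewrite big_distrr -big_split /=; apply: eq_bigr => p _.
by rewrite /bump /= big_ord_recl /= addnCA mulnDr [(_ * tag h)%N]mulnC.
Qed.

Lemma leq_tag_itcomp h (s : seq nat) xs : (tag h <= tag (itcomp h s xs))%N.
Proof.
rewrite /itcomp; elim: (zip s xs) => //= -[i y] t IH /=.
exact: leq_trans (leq_addr _ _).
Qed.

(** Unfolding the recursion gives the sum over increasing positions. The bound
    keeps all positions among the inputs of [h], where [comp_at] is the partial
    composition. *)
Lemma slot_brace_incseqs h a n xs : (a + n <= (tag h).+1)%N ->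
  slot_brace (emb h) a n xs = \sum_(s <- incseqs a n (size xs))
     (-1) ^+ brace_sign s xs *: emb (itcomp h s xs).
Proof.
elim: n a xs => [|n IH] a [|y xs] an /=; rewrite ?big_nil //.
- by rewrite big_seq1 /brace_sign big_ord0 scale1r.
- by rewrite big_seq1 /brace_sign big_ord0 scale1r.
rewrite big_cat big_map /= !IH ?addSnnS //; congr (_ + _).
rewrite (lin_sum (@comp_at_linl _ _ _ _)) scaler_sumr; apply: eq_bigr => s _.
rewrite comp_atZl comp_atE (leq_trans _ (leq_tag_itcomp h s xs)); last by lia.
rewrite scalerA -exprD brace_sign_cons; congr (_ *: _); sign_eq.
Qed.

Lemma hbraceE h xs : hbrace h xs = slot_brace (emb h) 0 (tag h).+1 xs.
Proof.
rewrite slot_brace_incseqs ?add0n //.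
exact: (sum_sorted_tuples (fun s => (-1) ^+ brace_sign s xs *: emb (itcomp h s xs))).
Qed.

Section Multilinear.
Variable W : lmodType k.
Implicit Types (F : seq T -> W) (zs : seq V).

(** Multilinearity of a function of a list of homogeneous elements, and its
    extension to lists of arbitrary elements. *)
Definition arg_linear F :=
  forall s1 s2 n, linear (fun u : O n => F (s1 ++ Tagged (opP O) u :: s2)).

Definition choice_sum F zs : W := \sum_(hs <- choices (map (@homparts k O) zs)) F hs.

Lemma choice_sum_cons F z zs :
  choice_sum F (z :: zs) = \sum_(h <- homparts z) choice_sum (fun t => F (h :: t)) zs.
Proof. by rewrite /choice_sum /= big_allpairs_dep. Qed.

Lemma arg_linear_cons F h : arg_linear F -> arg_linear (fun t => F (h :: t)).
Proof. by move=> Fl s1 s2 n; apply: (Fl (h :: s1)). Qed.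

Lemma choice_sum_emb F xs : arg_linear F -> choice_sum F (map emb xs) = F xs.
Proof.
elim: xs F => [|h xs IH] F Fl; first by rewrite /choice_sum /= big_seq1.
rewrite /= choice_sum_cons -(IH (fun t => F (h :: t))); last exact: arg_linear_cons.
apply: (@homparts_emb _ _ _ (fun h => choice_sum (fun t => F (h :: t)) (map emb xs))) => n.
by apply: (lin_bigsum _ (fun t u => F (Tagged (opP O) u :: t))) => t; apply: (Fl [::]).
Qed.

Lemma choice_sum_linear F s1 s2 :
  arg_linear F -> linear (fun y => choice_sum F (s1 ++ y :: s2)).
Proof.
elim: s1 F => [|z s1 IH] F Fl a u w /=.
  rewrite !choice_sum_cons;
    apply: (homparts_linear (f := fun h => choice_sum (fun t => F (h :: t)) s2)) => n.
  by apply: (lin_bigsum _ (fun t u => F (Tagged (opP O) u :: t))) => t; apply: (Fl [::]).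
rewrite !choice_sum_cons
  (lin_bigsum _ (fun h y => choice_sum (fun t => F (h :: t)) (s1 ++ y :: s2))) //.
by move=> h; apply: IH; apply: arg_linear_cons.
Qed.

End Multilinear.

Lemma slot_brace_arg_linear x a n : arg_linear (slot_brace x a n).
Proof.
elim: n a => [|n IH] a s1 s2 m b u w.
  by case: s1 => [|h s1] /=; rewrite scaler0 addr0.
case: s1 => [|h s1] /=.
  rewrite (IH _ [::]) emb_linear comp_at_linr !scalerDr !scalerA [b * _]mulrC.
  by rewrite addrACA.
rewrite (IH _ (h :: s1)) IH comp_at_linl !deg_cat !deg_cons /=.
by rewrite !scalerDr !scalerA [b * _]mulrC addrACA.
Qed.

Definition hom_brace h zs := choice_sum (slot_brace (emb h) 0 (tag h).+1) zs.

Lemma braceE x zs : brace x zs = \sum_(h <- homparts x) hom_brace h zs.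
Proof.
by apply: eq_bigr => h _; apply: eq_bigr => hs _; apply: hbraceE.
Qed.

Lemma brace_linl zs : linear (fun x => brace x zs).
Proof.
move=> a x y; rewrite !braceE (homparts_linear (f := fun h => hom_brace h zs)) // => n.
apply: (lin_bigsum _ (fun t u => slot_brace (emb (Tagged (opP O) u)) 0 n.+1 t)) => t.
by move=> b u w; rewrite emb_linear slot_brace_linear.
Qed.

Lemma brace_linr x s1 s2 : linear (fun y => brace x (s1 ++ y :: s2)).
Proof.
move=> a u w; rewrite !braceE.
apply: (lin_bigsum _ (fun h y => hom_brace h (s1 ++ y :: s2))) => h.
exact/choice_sum_linear/slot_brace_arg_linear.
Qed.

Lemma brace_emb h xs : brace (emb h) (map emb xs) = emb (tbrace h xs).
Proof.
rewrite braceE (@homparts_emb _ _ _ (fun h => hom_brace h (map emb xs))).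
  by rewrite /hom_brace choice_sum_emb ?emb_tbrace //; apply: slot_brace_arg_linear.
move=> n; apply: (lin_bigsum _ (fun t u =>
  slot_brace (emb (Tagged (opP O) u)) 0 n.+1 t)) => t.
by move=> b u w; rewrite emb_linear slot_brace_linear.
Qed.

Lemma brace_nil x : brace x [::] = x.
Proof.
elim/dsum_ind: x => [|x y Ex Ey|h].
- exact: (lin0 (@brace_linl _)).
- by rewrite (linD (@brace_linl _)) Ex Ey.
by rewrite (brace_emb h [::]) emb_tbrace slot_brace_nil.
Qed.

Lemma brace_brace h xs ys : brace (brace (emb h) (map emb xs)) (map emb ys) =
  isum (fun t => brace (emb h) (map emb t)) xs ys.
Proof.
rewrite !brace_emb emb_tbrace emb_tbrace tag_tbrace -addSn slot_brace_slot_brace.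
by apply: eq_isum => t; rewrite brace_emb emb_tbrace.
Qed.

End OperadicBraces.

(** * Insertions of one element and into operations of small arity *)

Section SpecialInsertions.
Variables (k : fieldType) (O : nsOperad k).
Local Notation V := (dsum O).
Local Notation T := {n & O n}.
Implicit Types (x y z : V) (h m : T) (xs ys : seq T).

Lemma emb_tag_inj h h' : tag h = tag h' -> emb h = emb h' -> h = h'.
Proof.
case: h h' => n u [n' u'] /= nn; case: _ / nn u' => u' /(congr1 (fun z : V => z n)).
by rewrite /= !dinj_id => ->.
Qed.

(** An equality of dependent pairs, not only of their images, since functions
    under a sum over insertions need not factor through [emb]. *)
Lemma tbrace_nil h : tbrace h [::] = h.
Proof. by apply: emb_tag_inj; rewrite ?emb_tbrace ?slot_brace_nil // tag_tbrace addn0. Qed.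

Section Sums.
Variable W : lmodType k.
Implicit Type F : seq T -> W.

Lemma isum_nilr F xs : isum F xs [::] = F xs.
Proof.
elim: xs F => [|h xs IH] F; first exact: isum_nil.
by rewrite isum_cons big_ord_recl big_ord0 !addr0 /= scale1r tbrace_nil IH.
Qed.

Lemma isum_seq1 F m ys : isum F [:: m] ys =
  \sum_(l < (size ys).+1) F (tbrace m (take l ys) :: drop l ys)
  + (if ys is y :: ys' then
       (-1) ^+ (tag y * tag m) *: isum (fun t => F (y :: t)) [:: m] ys' else 0).
Proof.
rewrite isum_cons; congr (_ + _).
  by apply: eq_bigr => l _; rewrite muln0 scale1r isum_nil.
by case: ys => // y ys; rewrite deg_cons addn0.
Qed.

(** If at most one argument is allowed, the inserted element takes everything. *)
Lemma isum_unary F m ys : (forall t, (1 < size t)%N -> F t = 0) ->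
  isum F [:: m] ys = F [:: tbrace m ys].
Proof.
move=> F0; rewrite isum_seq1 big_ord_recr /= take_size drop_size big1 ?add0r.
  case: ys => [|y ys]; first exact: addr0.
  by rewrite isum0 ?scaler0 ?addr0 // => t t0; apply: F0.
by move=> l _; apply: F0; rewrite /= ltnS size_drop subn_gt0.
Qed.

(** With room for two arguments only, [h] and [m] take all of [ys] between
    them. *)
Lemma isum_binary F h m ys : (forall t, (2 < size t)%N -> F t = 0) ->
  isum F [:: h; m] ys = \sum_(l < (size ys).+1)
    (-1) ^+ (deg (take l ys) * tag m) *: F [:: tbrace h (take l ys); tbrace m (drop l ys)].
Proof.
move=> F0; rewrite isum_cons [X in _ + X](_ : _ = 0) ?addr0.
  by apply: eq_bigr => l _; rewrite isum_unary ?deg_cons ?addn0 // => t t1; apply: F0.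
by case: ys => // y ys; rewrite isum0 ?scaler0 // => t t1; apply: F0.
Qed.

(** With room for two arguments, at most one end of the list stays outside of
    [h]; a middle element cannot. *)
Lemma isum_into_binary F h (y : T) ys : (forall t, (2 < size t)%N -> F t = 0) ->
  isum F [:: h] (y :: ys) =
    F [:: tbrace h (y :: ys)]
    + (-1) ^+ (tag y * tag h) *: F [:: y; tbrace h ys]
    + F [:: tbrace h (take (size ys) (y :: ys)); nth y (y :: ys) (size ys)].
Proof.
move=> F0; rewrite isum_seq1 isum_unary; last by move=> t t1; apply: F0.
rewrite addrAC; congr (_ + _).
rewrite big_ord_recr big_ord_recr /= take_size drop_size big1 ?add0r.
  rewrite addrC; congr (_ + F (_ :: _)).
  by rewrite (drop_nth y) //= drop_size.
case=> l lt_l _; apply: F0; rewrite /= ltnS size_drop /=.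
by rewrite -/(size ys) in lt_l; lia.
Qed.

(** A single element [m] either stands between two of the [xs] or is inserted
    into one of them. *)
Lemma isum_insert1 F m xs d : isum F xs [:: m] =
  \sum_(l < (size xs).+1)
    (-1) ^+ (tag m * deg (drop l xs)) *: F (take l xs ++ m :: drop l xs)
  + \sum_(l < size xs)
    (-1) ^+ (tag m * deg (drop l.+1 xs))
      *: F (take l xs ++ tbrace (nth d xs l) [:: m] :: drop l.+1 xs).
Proof.
elim: xs F => [|h xs IH] F.
  by rewrite isum_nil big_ord_recl !big_ord0 /= muln0 scale1r !addr0.
rewrite isum_cons isum_nilr big_ord_recl big_ord_recl big_ord0 /= isum_nilr !addr0.
rewrite scale1r tbrace_nil IH [in RHS]big_ord_recl [X in _ = _ + X]big_ord_recl /=.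
rewrite !deg_cons addn0 !drop0.
set a := _ *: F (m :: _); set b := _ *: F (tbrace _ _ :: _).
by rewrite [RHS]addrACA -[LHS]addrA [b + a]addrC addrC.
Qed.

(** As [m] is at most binary, it takes zero, one or two consecutive elements of
    [xs]. *)
Lemma isum_into1 F m xs d :
  (forall s1 s2 h, emb h = 0 -> F (s1 ++ h :: s2) = 0) ->
  (forall t, (2 < size t)%N -> emb (tbrace m t) = 0) ->
  isum F [:: m] xs =
  \sum_(l < (size xs).+1)
    (-1) ^+ (tag m * deg (take l xs)) *: F (take l xs ++ m :: drop l xs)
  + \sum_(l < size xs)
    (-1) ^+ (tag m * deg (take l xs))
      *: F (take l xs ++ tbrace m [:: nth d xs l] :: drop l.+1 xs)
  + \sum_(l < (size xs).-1)
    (-1) ^+ (tag m * deg (take l xs))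
      *: F (take l xs ++ tbrace m [:: nth d xs l; nth d xs l.+1] :: drop l.+2 xs).
Proof.
move=> F0 m0; elim: xs F F0 => [|h xs IH] F F0.
  by rewrite isum_nilr big_ord_recl !big_ord0 /= muln0 scale1r !addr0.
rewrite isum_seq1 IH; last by move=> s1 s2 h'; apply: (F0 (h :: s1)).
have E (w1 w2 w3 u1 u2 u3 : W) :
    w1 + w2 + w3 + (u1 + u2 + u3) = (w1 + u1) + (w2 + u2) + (w3 + u3).
  by rewrite addrACA [w1 + w2 + _]addrACA.
have signS l w : (-1) ^+ (tag h * tag m) *: ((-1) ^+ (tag m * deg (take l xs)) *: w)
   = (-1) ^+ (tag m * deg (take l.+1 (h :: xs))) *: w :> W.
  by rewrite scalerA -exprD; congr (_ *: _); rewrite /= deg_cons; sign_eq.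
(* The term in which [m] takes the first two elements, if there are two. *)
pose c := if xs is y :: xs' then F (tbrace m [:: h; y] :: xs') else 0.
have -> : \sum_(l < (size (h :: xs)).+1) F (tbrace m (take l (h :: xs)) :: drop l (h :: xs))
    = F (m :: h :: xs) + F (tbrace m [:: h] :: xs) + c.
  rewrite big_ord_recl big_ord_recl addrA /= take0 drop0 tbrace_nil; congr (_ + _).
  rewrite /c; case: (xs) => [|y xs']; first by rewrite big_ord0.
  rewrite big_ord_recl /= take0 drop0 big1 ?addr0 // => l _.
  by apply: (F0 [::]); apply: m0; rewrite /= !ltnS size_take; case: ifP => // _;
    apply: leq_trans (ltn_ord l).
have -> : \sum_(l < (size (h :: xs)).-1) (-1) ^+ (tag m * deg (take l (h :: xs))) *:
     F (take l (h :: xs) ++ tbrace m [:: nth d (h :: xs) l; nth d (h :: xs) l.+1]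
        :: drop l.+2 (h :: xs))
   = c + \sum_(l < (size xs).-1) (-1) ^+ (tag m * deg (take l.+1 (h :: xs))) *:
     F (h :: take l xs ++ tbrace m [:: nth d xs l; nth d xs l.+1] :: drop l.+2 xs).
  rewrite /c; case: (xs) => [|y xs'] /=; first by rewrite !big_ord0 addr0.
  by rewrite big_ord_recl /= muln0 scale1r drop0.
rewrite !scalerDr !scaler_sumr E; congr (_ + _ + _).
- rewrite [RHS]big_ord_recl /= muln0 scale1r; congr (_ + _).
  by apply: eq_bigr => l _; rewrite signS.
- rewrite [RHS]big_ord_recl /= muln0 scale1r drop0; congr (_ + _).
  by apply: eq_bigr => l _; rewrite signS.
- by congr (_ + _); apply: eq_bigr => l _; rewrite signS.
Qed.

End Sums.
End SpecialInsertions.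

(** * Insertions as interleaved index sequences *)

Lemma big_tuple_cons (W : nmodType) (I : finType) r (P : pred (r.+1.-tuple I))
    (F : r.+1.-tuple I -> W) :
  \sum_(t | P t) F t =
    \sum_(i : I) \sum_(t : r.-tuple I | P [tuple of i :: t]) F [tuple of i :: t].
Proof.
rewrite pair_big_dep /= (reindex (fun p : I * r.-tuple I => [tuple of p.1 :: p.2])) //=.
exists (fun t => (thead t, [tuple of behead t])) => [[i t]|t] _ /=.
  by congr pair; apply: val_inj.
by rewrite [RHS]tuple_eta.
Qed.

Lemma big_tuple0 (W : nmodType) (I : finType) (P : pred (0.-tuple I))
    (F : 0.-tuple I -> W) :
  \sum_(t | P t) F t = if P [tuple] then F [tuple] else 0.
Proof.
by rewrite big_mkcond (big_pred1 [tuple]) // => t; apply/esym/eqP/tuple0.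
Qed.

Section Interleavings.
Variables (k : fieldType) (O : nsOperad k).
Local Notation V := (dsum O).
Local Notation T := {n & O n}.
Implicit Types (x y z h m : T) (xs ys : seq T).

Fixpoint insertT (j : nat) (ij : seq (nat * nat)) xs ys : seq T :=
  match ij, xs with
  | (i1, j1) :: ij', x :: xs' =>
      slice j i1 ys ++ tbrace x (slice i1 j1 ys) :: insertT j1 ij' xs' ys
  | _, _ => drop j ys
  end.

Lemma map_emb_slice i j ys : slice i j (map emb ys) = map emb (slice i j ys) :> seq V.
Proof. by rewrite /slice map_take map_drop. Qed.

Lemma insert_args_emb j ij xs ys :
  insert_args (@brace k O) j ij (map emb xs) (map emb ys) = map emb (insertT j ij xs ys).
Proof.
elim: ij j xs => [|[i1 j1] ij IH] j [|x xs] /=; rewrite ?map_drop //.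
by rewrite map_cat /= !map_emb_slice brace_emb IH.
Qed.

Definition insertT_sign (i : seq nat) xs ys : nat :=
  (\sum_(p <- zip xs i) tag p.1 * deg (take p.2 ys))%N.

Section Sum.
Variable W : lmodType k.
Implicit Type F : seq T -> W.

(** The part of the sum over insertions in which the first element takes
    y_(i+1), .., y_j, the first [a] of the [ys] having been used. *)
Definition insert_term F x xs ys a i j : W :=
  (-1) ^+ (tag x * deg (take i ys) + deg xs * deg (take j ys)) *:
    isum (fun t => F (slice a i ys ++ tbrace x (slice i j ys) :: t)) xs (drop j ys).

(** The recursion for insertions decides one element of [ys] at a time, while
    interleaved indices jump to the place [i] where [x] starts; the terms with
    [i = a] are those in which [x] comes next. *)
Lemma isum_slices F x xs ys a : (a <= size ys)%N ->
  \sum_(a <= i < (size ys).+1) \sum_(i <= j < (size ys).+1) insert_term F x xs ys a i j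
  = (-1) ^+ (deg (x :: xs) * deg (take a ys)) *: isum F (x :: xs) (drop a ys).
Proof.
move=> ays; have [n an] : exists n, (a + n)%N = size ys.
  by exists (size ys - a)%N; rewrite subnKC.
elim: n a an F {ays} => [|n IH] a an F.
  rewrite addn0 in an; rewrite an !big_nat1 /insert_term /slice subnn take0 drop_size.
  by rewrite !isum_nilr tbrace_nil -mulnDl.
rewrite big_ltn; last by rewrite ltnS -an leq_addr.
rewrite [drop a ys](drop_nth x); last by rewrite -an; lia.
rewrite isum_cons scalerDr; congr (_ + _).
  rewrite -{1}(add0n a) big_addn big_mkord scaler_sumr.
  have -> : ((size ys).+1 - a = (size (nth x ys a :: drop a.+1 ys)).+1)%N.
    by rewrite /= size_drop -an; lia.
  apply: eq_bigr => -[l lt_l] _; rewrite [nat_of_ord _]/= {lt_l} -drop_nth;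
    last by rewrite -an; lia.
  rewrite /insert_term /slice subnn take0 addnK drop_drop scalerA -exprD [(l + a)%N]addnC.
  congr (_ *: _); rewrite takeD deg_cat deg_cons; sign_eq.
transitivity (\sum_(a.+1 <= i < (size ys).+1) \sum_(i <= j < (size ys).+1)
    insert_term (fun t => F (nth x ys a :: t)) x xs ys a.+1 i j).
  apply: eq_big_nat => i /andP[ai iys]; apply: eq_bigr => j _.
  rewrite /insert_term; congr (_ *: _); apply: eq_isum => t.
  congr F; rewrite /slice (drop_nth x) -?an; last lia.
  by rewrite -(subnSK ai).
rewrite IH; last by rewrite -an; lia.
rewrite scalerA -exprD; congr (_ *: _).
rewrite (take_nth x) -?an -?cats1 ?deg_cat; last lia.
rewrite !deg_cons addn0; sign_eq.
Qed.

Lemma isum_tuples F xs ys a : (a <= size ys)%N ->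
  \sum_(i : (size xs).-tuple 'I_(size ys).+1)
  \sum_(j : (size xs).-tuple 'I_(size ys).+1 |
      path leq a (flatten [seq [:: p.1; p.2] | p <- zip (map val i) (map val j)]))
    (-1) ^+ insertT_sign (map val i) xs ys *:
    F (insertT a (zip (map val i) (map val j)) xs ys)
  = (-1) ^+ (deg xs * deg (take a ys)) *: isum F xs (drop a ys).
Proof.
elim: xs a F => [|x xs IH] a F ays.
  by rewrite big_tuple0 big_tuple0 /= /insertT_sign big_nil isum_nil.
rewrite -isum_slices // big_tuple_cons.
rewrite big_geq_mkord [RHS]big_mkcond; apply: eq_bigr => i _.
under eq_bigr => t _ do rewrite big_tuple_cons.
rewrite exchange_big big_geq_mkord /= [X in if _ then X else _]big_mkcond /=.
have -> (b : bool) (G : 'I_(size ys).+1 -> W) :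
    (if b then \sum_(j < (size ys).+1) (if (i <= j)%N then G j else 0) else 0)
    = \sum_(j < (size ys).+1) (if b && (i <= j)%N then G j else 0).
  by case: b; rewrite // big1.
apply: eq_bigr => j _; case: ifP => [/andP[ai ij]|nij]; last first.
  rewrite big1 // => t _; rewrite big_pred0 // => t'.
  by rewrite andbA nij.
have := IH j (fun t => F (slice a i ys ++ tbrace x (slice i j ys) :: t)).
rewrite -ltnS ltn_ord => /(_ isT) IHj.
rewrite /insert_term exprD -scalerA -IHj scaler_sumr.
apply: eq_bigr => t _; rewrite scaler_sumr ij ai; apply: eq_bigr => t' _.
by rewrite scalerA -exprD /insertT_sign /= big_cons.
Qed.
End Sum.
End Interleavings.

(** * Cup product and differential on homogeneous elements *)

Section CupAndDifferential.
Variables (k : fieldType) (O : nsOperad k) (mu : O 1%N).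
Local Notation V := (dsum O).
Local Notation T := {n & O n}.
Implicit Types (x y z : V) (h m : T) (xs ys : seq T).

Lemma slot_brace_seq1 x a n h : slot_brace x a n [:: h] =
  \sum_(i < n) (-1) ^+ (tag h * (a + i)) *: comp_at (a + i) x (emb h).
Proof.
elim: n a => [|n IH] a /=; first by rewrite big_ord0.
rewrite slot_brace_nil IH big_ord_recl addrC addn0; congr (_ + _).
by apply: eq_bigr => i _; rewrite /bump /= addSnnS.
Qed.

Lemma slot_brace_eq0 x a n ys : (n < size ys)%N -> slot_brace x a n ys = 0.
Proof.
elim: n a ys => [|n IH] a [|y ys] //= nys.
by rewrite (IH _ ys) // comp_at0l scaler0 addr0 IH // ltnW.
Qed.

Definition hbr h xs : V := brace (emb h) (map emb xs).

Lemma hbrE h xs : hbr h xs = emb (tbrace h xs). Proof. exact: brace_emb. Qed.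

(** The operation x o y is the brace x{y}. *)
Lemma emb_circ n p (u : O n) (w : O p) :
  emb (Tagged (opP O) (circ u w)) = hbr (Tagged (opP O) u) [:: Tagged (opP O) w].
Proof.
rewrite hbrE emb_tbrace slot_brace_seq1 /circ (lin_sum (@emb_linear _ _ _)).
apply: eq_bigr => i _; rewrite (linZ (@emb_linear _ _ _)) comp_atE /= -ltnS ltn_ord mulnC.
by rewrite /tcomp /= add0n inord_val.
Qed.

Let M : T := Tagged (opP O) mu.

Lemma cup_emb h h' : cup mu (emb h) (emb h') = (-1) ^+ (tag h).+1 *: hbr M [:: h; h'].
Proof.
pose f h h' : V := (-1) ^+ (tag h).+1 *: hbrace M [:: h; h'].
have fl h0 n : linear (fun u : O n => f (Tagged (opP O) u) h0).
  move=> a u w; rewrite /f !hbraceE (slot_brace_arg_linear _ _ _ [::] [:: h0]).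
  by rewrite scalerDr !scalerA mulrC.
have fr h0 n : linear (fun u : O n => f h0 (Tagged (opP O) u)).
  move=> a u w; rewrite /f !hbraceE (slot_brace_arg_linear _ _ _ [:: h0] [::]).
  by rewrite scalerDr !scalerA mulrC.
rewrite /cup (@homparts_emb _ _ _ (fun h => \sum_(h' <- homparts (emb h')) f h h')).
  by rewrite (@homparts_emb _ _ _ (f h)) // hbrE emb_tbrace /f hbraceE.
by move=> n; apply: lin_bigsum => h0; apply: fl.
Qed.

Lemma cup_linl y : linear (fun x => cup mu x y).
Proof.
apply: homparts_linear => n; apply: lin_bigsum => h0 a u w.
by rewrite !hbraceE (slot_brace_arg_linear _ _ _ [::] [:: h0]) scalerDr !scalerA mulrC.
Qed.

Lemma cup_linr x : linear (cup mu x).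
Proof.
apply: lin_bigsum => h0; apply: homparts_linear => n a u w.
by rewrite !hbraceE (slot_brace_arg_linear _ _ _ [:: h0] [::]) scalerDr !scalerA mulrC.
Qed.

Let odiff_hom h : V :=
  dinj (circ mu (tagged h)) - (-1) ^+ tag h *: dinj (circ (tagged h) mu).

Let odiff_homE h : odiff_hom h = hbr M [:: h] - (-1) ^+ tag h *: hbr h [:: M].
Proof. by rewrite /odiff_hom; case: h => n u; rewrite -!emb_circ. Qed.

Let odiff_hom_linear n : linear (fun u : O n => odiff_hom (Tagged (opP O) u)).
Proof.
move=> a u w; rewrite !odiff_homE /hbr [map _ _]/= emb_linear brace_linl.
rewrite (@brace_linr _ _ _ [::] [::]) !scalerDr !scalerN opprD addrACA.
by rewrite !scalerA [a * _]mulrC.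
Qed.

Lemma odiff_linear : linear (odiff mu).
Proof. exact: homparts_linear. Qed.

Lemma odiff_emb h : odiff mu (emb h) = hbr M [:: h] - (-1) ^+ tag h *: hbr h [:: M].
Proof. by rewrite -odiff_homE; apply: homparts_emb. Qed.

Lemma hbr_eq0 h s1 s2 h' : emb h' = 0 -> hbr h (s1 ++ h' :: s2) = 0.
Proof. by move=> h0; rewrite /hbr map_cat /= h0 (lin0 (@brace_linr _ _ _ _ _)). Qed.

Lemma hbr_emb0 h xs : emb h = 0 -> hbr h xs = 0.
Proof. by move=> h0; rewrite /hbr h0 (lin0 (@brace_linl _ _ _)). Qed.

Lemma hbr_tbrace h xs ys : hbr (tbrace h xs) ys = isum (hbr h) xs ys.
Proof. by rewrite {1}/hbr -brace_emb brace_brace. Qed.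

Lemma hbr_mu0 t : (2 < size t)%N -> hbr M t = 0.
Proof. by move=> t2; rewrite hbrE emb_tbrace slot_brace_eq0. Qed.

Hypothesis muP : is_multiplication mu.

(** The expansion of mu{mu}{ys} = 0, from which all relations for [mu] are
    derived. *)
Lemma isum_mu_mu ys : isum (hbr M) [:: M] ys = 0.
Proof.
rewrite -hbr_tbrace hbr_emb0 // -hbrE -emb_circ (muP : circ mu mu = 0).
exact: (lin0 (@emb_linear _ _ _)).
Qed.
End CupAndDifferential.

(** * Consequences of the multiplication axiom *)

Lemma subr_eq_subr (W : zmodType) (a b c d : W) : a + d = c + b -> a - b = c - d.
Proof. by move=> E; apply/eqP; rewrite subr_eq addrAC -E addrK. Qed.

(** In the proof of axiom (d), [p] stands for the terms with mu as an argument
    of x, [q] and [r] for those with mu{x_i} and x_i{mu}, [t] for those with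
    mu{x_i, x_(i+1)}, [m] for mu{x{xs}}, and [c1], [c2] for mu{x_1, x{..}} and
    mu{x{..}, x_N}. *)
Lemma odiff_brace_cancel (W : zmodType) (m p q r t c1 c2 : W) :
  m - (p + r) - (m + c1 + c2 - (p + q + t)) - (q - r) = - c1 - c2 + t.
Proof.
rewrite !opprB [X in X + _ = _]addrACA -opprD [LHS]addrACA -opprD.
rewrite -opprD [RHS]addrC; apply: subr_eq_subr.
by rewrite [LHS](AC (1*3*1*2) (4*(((2*5)*((1*6)*7))*3))).
Qed.

Section HomogeneousAxioms.
Variables (k : fieldType) (O : nsOperad k) (mu : O 1%N).
Local Notation V := (dsum O).
Local Notation T := {n & O n}.
Implicit Types (x y z h m : T) (xs ys zs : seq T).
Local Notation M := (Tagged (opP O) mu).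
Hypothesis muP : is_multiplication mu.

Lemma hbr_mu3 x y z xs : hbr M [:: x, y, z & xs] = 0.
Proof. exact: hbr_mu0. Qed.

(** mu{mu}{x, y, z} = 0, the associativity of the cup product. *)
Lemma hbr_mu_assoc x y z :
  hbr M [:: tbrace M [:: x; y]; z] + (-1) ^+ tag x *: hbr M [:: x; tbrace M [:: y; z]] = 0.
Proof.
rewrite -(isum_mu_mu muP [:: x; y; z]) (@isum_into1 _ _ _ _ M _ M); first last.
- by move=> t t2; rewrite -hbrE hbr_mu0.
- by move=> s1 s2 h h0; apply: hbr_eq0.
rewrite !big_ord_recl !big_ord0 /= !hbr_mu3 !scaler0 !add0r.
by rewrite muln0 scale1r !addr0 deg_cons addn0 mul1n.
Qed.

(** mu{mu}{x, y} = 0, the part of the derivation rule that involves only left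
    composition with mu. *)
Lemma hbr_mu_deriv x y :
  hbr M [:: tbrace M [:: x]; y] + (-1) ^+ tag x *: hbr M [:: x; tbrace M [:: y]]
  + hbr M [:: tbrace M [:: x; y]] = 0.
Proof.
rewrite -(isum_mu_mu muP [:: x; y]) (@isum_into1 _ _ _ _ M _ M); first last.
- by move=> t t2; rewrite -hbrE hbr_mu0.
- by move=> s1 s2 h h0; apply: hbr_eq0.
rewrite !big_ord_recl !big_ord0 /= !hbr_mu3 !scaler0 !add0r.
by rewrite muln0 !scale1r !addr0 deg_cons addn0 mul1n.
Qed.

(** mu{mu}{x} = 0: the terms mu{mu, x} and mu{x, mu} cancel those of
    mu{x}{mu} in d^2. *)
Lemma hbr_mu_square x :
  hbr M [:: M; x] + (-1) ^+ tag x *: hbr M [:: x; M] + hbr M [:: tbrace M [:: x]] = 0.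
Proof.
rewrite -(isum_mu_mu muP [:: x]) (@isum_into1 _ _ _ _ M _ M); first last.
- by move=> t t2; rewrite -hbrE hbr_mu0.
- by move=> s1 s2 h h0; apply: hbr_eq0.
rewrite !big_ord_recl !big_ord0 /=.
by rewrite muln0 !scale1r !addr0 deg_cons addn0 mul1n.
Qed.

Lemma cup0l w : cup mu 0 w = 0. Proof. exact: (lin0 (@cup_linl _ _ mu w)). Qed.
Lemma cup0r w : cup mu w 0 = 0. Proof. exact: (lin0 (@cup_linr _ _ mu w)). Qed.
Lemma cupDl u v w : cup mu (u + v) w = cup mu u w + cup mu v w.
Proof. exact: (linD (@cup_linl _ _ mu w)). Qed.
Lemma cupDr u v w : cup mu w (u + v) = cup mu w u + cup mu w v.
Proof. exact: (linD (@cup_linr _ _ mu w)). Qed.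
Lemma cupZl a u w : cup mu (a *: u) w = a *: cup mu u w.
Proof. exact: (linZ (@cup_linl _ _ mu w)). Qed.
Lemma cupZr a u w : cup mu w (a *: u) = a *: cup mu w u.
Proof. exact: (linZ (@cup_linr _ _ mu w)). Qed.

Lemma cupA : associative (cup mu).
Proof.
move=> u v w.
elim/dsum_ind: u => [|u u' Eu Eu'|x]; rewrite ?cup0l ?cupDl ?Eu ?Eu' //.
elim/dsum_ind: v => [|v v' Ev Ev'|y].
- by rewrite cup0l cup0r cup0l.
- by rewrite !(cupDl, cupDr) Ev Ev'.
elim/dsum_ind: w => [|w w' Ew Ew'|z]; rewrite ?cup0r ?cupDr ?Ew ?Ew' //.
rewrite !cup_emb cupZl cupZr !hbrE !cup_emb !signZ.
move/eqP: (hbr_mu_assoc x y z); rewrite addr_eq0 => /eqP ->.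
rewrite signN !signZ; congr (_ *: _); rewrite !tag_tbrace /deg; sign_eq.
Qed.

(** Two more cancellations are used besides mu{mu}{h} = 0: mu{h{mu}} occurs in
    both d(mu{h}) and d(h{mu}), and h{mu}{mu} = h{mu{mu}} = 0, as the
    second mu contributes opposite signs on either side of the first. *)
Lemma odiff_odiff u : odiff mu (odiff mu u) = 0.
Proof.
elim/dsum_ind: u => [|u v Eu Ev|h].
- by rewrite !(lin0 (@odiff_linear _ _ mu)).
- by rewrite !(linD (@odiff_linear _ _ mu)) Eu Ev addr0.
have L := @odiff_linear _ _ mu.
rewrite odiff_emb (linD L) signN signZ (linZ L) !hbrE !odiff_emb !hbr_tbrace.
rewrite !(isum_insert1 _ M _ M) !big_ord_recl !big_ord0 /= !addr0.
have E0 : hbr h [:: tbrace M [:: M]] = 0.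
  by apply: (hbr_eq0 h [::] [::]); rewrite -hbrE -(isum_mu_mu muP [::]) isum_nilr.
rewrite E0 scaler0 addr0.
move/eqP: (hbr_mu_square h); rewrite addrC addr_eq0 => /eqP ->.
have -> : deg [:: h] = tag h by rewrite deg_cons addn0.
rewrite /deg /= !addn0 !muln0 !mul1n !scale1r expr1 scaleN1r addNr scaler0 subr0.
rewrite add1n exprS mulN1r !scaleNr opprK !scalerDr signZ.
by rewrite -[(-1) ^+ (_ + _)]signr_odd addnn odd_double scale1r addKr subrr.
Qed.

Lemma cup_hbrl x xs y : cup mu (hbr x xs) (emb y) =
  (-1) ^+ (tag x + deg xs).+1 *: hbr M [:: tbrace x xs; y].
Proof. by rewrite hbrE cup_emb. Qed.

Lemma cup_hbr x y ys : cup mu (emb x) (hbr y ys) =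
  (-1) ^+ (tag x).+1 *: hbr M [:: x; tbrace y ys].
Proof. by rewrite [hbr y ys]hbrE cup_emb. Qed.

Lemma odiff_cup x y : odiff mu (cup mu (emb x) (emb y)) =
  cup mu (odiff mu (emb x)) (emb y)
  + (-1) ^+ (tag x).+1 *: cup mu (emb x) (odiff mu (emb y)).
Proof.
have L := @odiff_linear _ _ mu.
rewrite cup_emb (linZ L) hbrE !odiff_emb !signN !signZ cupDl cupDr cupZl cupZr.
rewrite !cup_hbrl !cup_hbr !hbr_tbrace !(isum_insert1 _ M _ M) !big_ord_recl !big_ord0 /=.
rewrite !addr0 !hbr_mu3 !scaler0 !addr0 !add0r.
move/eqP: (hbr_mu_deriv x y); rewrite addrC addr_eq0 => /eqP ->.
rewrite !signN !scalerDr !signZ.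
rewrite [LHS]addrACA /deg.
by congr (_ *: _ + _ *: _ + (_ *: _ + _ *: _)); sign_eq.
Qed.

Lemma cup_brace x y zs : brace (cup mu (emb x) (emb y)) (map emb zs) =
  \sum_(l < (size zs).+1) (-1) ^+ ((tag y).+1 * deg (take l zs)) *:
     cup mu (brace (emb x) (map emb (take l zs))) (brace (emb y) (map emb (drop l zs))).
Proof.
rewrite cup_emb (linZ (@brace_linl _ _ _)) hbrE -/(hbr _ _) hbr_tbrace.
rewrite isum_binary; last exact: hbr_mu0.
rewrite scaler_sumr; apply: eq_bigr => l _.
rewrite !brace_emb cup_emb !signZ; congr (_ *: _); rewrite tag_tbrace; sign_eq.
Qed.

Lemma hbr_cat x s1 h s2 :
  hbr x (s1 ++ h :: s2) = brace (emb x) (map emb s1 ++ emb h :: map emb s2).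
Proof. by rewrite /hbr map_cat. Qed.

(** Axiom (d), with at least one argument so that x_1 and x_N exist. The two
    sums with mu in the place of an argument agree because, relative to
    [deg xs], the elements after that place and those before it have
    complementary degrees. *)
Lemma odiff_brace x y ys (xs := y :: ys) (v := map emb xs) :
  odiff mu (brace (emb x) v) - brace (odiff mu (emb x)) v
  - (-1) ^+ tag x *: (\sum_(i < size xs) (-1) ^+ deg (take i xs) *:
       brace (emb x) (take i v ++ odiff mu (nth 0 v i) :: drop i.+1 v))
  = (-1) ^+ ((tag x).+1 * deg (take 1 xs)) *: cup mu (nth 0 v 0) (brace (emb x) (drop 1 v))
    + (-1) ^+ (tag x + deg (take (size ys) xs)) *:
        cup mu (brace (emb x) (take (size ys) v)) (nth 0 v (size ys))
    - (-1) ^+ tag x *: (\sum_(i < size ys) (-1) ^+ deg (take i.+1 xs) *: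
        brace (emb x) (take i v ++ cup mu (nth 0 v i) (nth 0 v i.+1) :: drop i.+2 v)).
Proof.
have nv i : (i < size xs)%N -> nth 0 v i = emb (nth M xs i).
  by move=> ix; rewrite (nth_map M).
have -> : \sum_(i < size xs) (-1) ^+ deg (take i xs) *:
       brace (emb x) (take i v ++ odiff mu (nth 0 v i) :: drop i.+1 v)
  = \sum_(i < size xs) (-1) ^+ deg (take i xs) *:
       hbr x (take i xs ++ tbrace M [:: nth M xs i] :: drop i.+1 xs)
  - \sum_(i < size xs) (-1) ^+ deg (take i.+1 xs) *:
       hbr x (take i xs ++ tbrace (nth M xs i) [:: M] :: drop i.+1 xs).
  rewrite -sumrB; apply: eq_bigr => i _;
    rewrite nv // odiff_emb !hbr_cat !map_take !map_drop !hbrE.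
  have L := @brace_linr _ _ (emb x) (take i v) (drop i.+1 v).
  rewrite (linD L) signN signZ (linZ L) scalerDr signZ [in RHS]signN signZ.
  congr (_ + _ *: _).
  by rewrite (deg_takeS M) //; sign_eq.
have -> : \sum_(i < size ys) (-1) ^+ deg (take i.+1 xs) *:
        brace (emb x) (take i v ++ cup mu (nth 0 v i) (nth 0 v i.+1) :: drop i.+2 v)
  = - \sum_(i < size ys) (-1) ^+ deg (take i xs) *:
       hbr x (take i xs ++ tbrace M [:: nth M xs i; nth M xs i.+1] :: drop i.+2 xs).
  rewrite -sumrN; apply: eq_bigr => i _.
  have ix : (i < size xs)%N by apply: ltn_trans (ltn_ord i) _.
  have ix' : (i.+1 < size xs)%N by exact: (ltn_ord i).
  rewrite (nv _ ix) (nv _ ix') cup_emb hbr_cat map_take map_drop hbrE.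
  rewrite (linZ (@brace_linr _ _ (emb x) (take i v) (drop i.+2 v))) signN !signZ;
    congr (_ *: _).
  by rewrite (deg_takeS M) //; sign_eq.
rewrite -/(hbr x xs) hbrE odiff_emb odiff_emb.
(* The names match the letters p, q, r, t of [odiff_brace_cancel] as [Q1], [Q2],
   [R2] and [Q3], up to the common sign [s]. *)
set Q2 := \sum_(i < size xs) _; set R2 := \sum_(i < size xs) _.
set Q3 := \sum_(i < size ys) _; pose s := (-1) ^+ tag x : k.
have -> : brace (hbr M [:: x] - (-1) ^+ tag x *: hbr x [:: M]) v
    = isum (hbr M) [:: x] xs - s *: isum (hbr x) [:: M] xs.
  have L := @brace_linl _ _ v.
  by rewrite (linB L) (linZ L) -!hbr_tbrace /hbr !brace_emb.
pose Q1 :=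
  \sum_(l < (size xs).+1) (-1) ^+ deg (take l xs) *: hbr x (take l xs ++ M :: drop l xs).
have -> : isum (hbr x) [:: M] xs = Q1 + Q2 + Q3.
  rewrite (@isum_into1 _ _ _ _ M _ M); first last.
  - by move=> t t2; rewrite -hbrE hbr_mu0.
  - by move=> s1 s2 h h0; apply: hbr_eq0.
  by congr (_ + _ + _); apply: eq_bigr => i _; rewrite mul1n.
have -> : (-1) ^+ tag (tbrace x xs) *: hbr (tbrace x xs) [:: M] = s *: Q1 + s *: R2.
  rewrite hbr_tbrace (isum_insert1 _ M _ M) scalerDr !scaler_sumr tag_tbrace.
  congr (_ + _); apply: eq_bigr => i _; rewrite !signZ; congr (_ *: _).
    by rewrite (deg_split i xs); sign_eq.
  by rewrite (deg_split i.+1 xs); sign_eq.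
rewrite isum_into_binary; last exact: hbr_mu0.
rewrite !scalerDr !scalerN opprK odiff_brace_cancel; congr (_ + _ + _).
- have -> : brace (emb x) (drop 1 v) = hbr x ys by rewrite /v /= drop0.
  rewrite (nv 0%N) // cup_hbr signN !signZ; congr (_ *: _).
  by rewrite /xs /= take0 deg_cons; sign_eq.
rewrite (nv (size ys)) // -[take _ v]map_take -/(hbr x _) cup_hbrl signN !signZ.
congr (_ *: hbr M [:: _; _]); last by apply: set_nth_default.
sign_eq.
Qed.
End HomogeneousAxioms.

(** * The homotopy G-algebra of a multiplicative operad *)

Lemma odd_abszD (a b : int) : odd (absz (a + b)) = odd (absz a) (+) odd (absz b).
Proof. lia. Qed.

Section Signs.
Variable k : fieldType.

Lemma sgE (e : int) : sg k e = (-1) ^+ absz e.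
Proof. by case: e => n //=; rewrite /sg NegzE -invr_expz ?invr_sign. Qed.

Lemma sg_odd (e : int) n : odd (absz e) = odd n -> sg k e = (-1) ^+ n.
Proof. by rewrite sgE; apply: sign_odd. Qed.
End Signs.

Section Grading.
Variables (k : fieldType) (P : nat -> lmodType k).

Lemma dsum_gr_emb (h : {n & P n}) : dsum_gr P (tag h).+1 (emb h).
Proof. by move=> n; rewrite eqz_nat eqSS eq_sym => /(emb_neq (h := h)). Qed.

Lemma dsum_gr_lin z a (u v : dsum P) :
  dsum_gr P z u -> dsum_gr P z v -> dsum_gr P z (a *: u + v).
Proof. by move=> gu gv n nz; rewrite dcompD dcompZ gu ?gv // scaler0 addr0. Qed.

Lemma dsum_gr_le0 z (u : dsum P) : dsum_gr P z u -> z <= 0 -> u = 0.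
Proof. by move=> gu z0; apply: dsumP => n; apply: gu; lia. Qed.

Lemma dcomp_sum (I : Type) (r : seq I) (F : I -> dsum P) n :
  (\sum_(i <- r) F i) n = \sum_(i <- r) F i n.
Proof. exact: (lin_sum (@dcomp_linear k P n)). Qed.

Lemma dsum_grading : is_grading (dsum_gr P).
Proof.
split=> [//|||].
- by move=> n; apply: dsum_gr_lin.
- move=> v; pose c (z : int) : dsum P :=
    if z is Posz n.+1 then emb (Tagged P (v n)) else 0.
  exists [seq n.+1%:Z | n <- iota 0 (dbound v)], c; split.
    by case=> [[|n]|n] //; exact: (@dsum_gr_emb (Tagged P (v n))).
  by rewrite big_map [LHS]homparts_sum big_map.
move=> s c us cg c0 n ns; apply: dsumP => m.
have [mn|mn] := eqVneq m.+1%:Z n; last exact: cg.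
have := congr1 (fun u : dsum P => u m) c0; rewrite /= dcomp_sum (bigD1_seq n) //=.
by rewrite big1 ?addr0 // => i; rewrite -mn eq_sym; apply: cg.
Qed.

(** A nonzero homogeneous element has degree at least 0. The zero vector may be
    declared homogeneous of negative degree; the absolute value is then as good
    as any other, since it has the right parity for all signs. *)
Definition tag_homog (x : homog (dsum_gr P)) : {n & P n} :=
  Tagged P (hval x (absz (hdeg x))).

Lemma emb_tag_homog x : emb (tag_homog x) = hval x.
Proof.
apply: dsumP => n; have [<-|nx] := eqVneq (tag (tag_homog x)) n; first exact: emb_comp.
rewrite emb_neq //; case: x nx => c v gv; rewrite /tag_homog /hdeg /= => nx.
by rewrite gv //; lia.
Qed.

Lemma hvals_tag_homog xs : hvals xs = map emb (map tag_homog xs).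
Proof. by rewrite -map_comp; apply: eq_map => x; rewrite /= emb_tag_homog. Qed.
End Grading.

Section HomotopyGAxioms.
Variables (k : fieldType) (O : nsOperad k) (mu : O 1%N).
Local Notation V := (dsum O).
Local Notation T := {n & O n}.
Local Notation H := (homog (dsum_gr O)).
Local Notation M := (Tagged (opP O) mu).
Implicit Types (x y z : H) (xs ys zs : seq H).
Hypothesis muP : is_multiplication mu.

Lemma odd_hdegs xs : odd (absz (hdegs xs)) = odd (deg (map (@tag_homog k O) xs)).
Proof.
elim: xs => [|x xs IH]; first by rewrite /hdegs big_nil.
by rewrite /hdegs big_cons odd_abszD IH deg_cons oddD.
Qed.

Lemma odd_insert_sign i xs ys :
  odd (absz (insert_sign i xs ys)) =
    odd (insertT_sign i (map (@tag_homog k O) xs) (map (@tag_homog k O) ys)).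
Proof.
rewrite /insert_sign /insertT_sign; elim: xs i => [|x xs IH] [|j i] /=; rewrite ?big_nil //.
by rewrite !big_cons odd_abszD oddD IH abszM !oddM odd_hdegs map_take.
Qed.

Lemma hdeg_tag_homog x : 0 <= hdeg x -> hdeg x = tag (tag_homog x).
Proof. by move=> x0; rewrite /= gez0_abs. Qed.

Lemma hdeg_lt0 x : hdeg x < 0 -> hval x = 0.
Proof. by case: x => c v gv; rewrite /hdeg /= => c0; apply: (dsum_gr_le0 gv); lia. Qed.

Lemma dsum_gr_eq (z z' : int) (u : V) : dsum_gr O z u -> z = z' -> dsum_gr O z' u.
Proof. by move=> + <-. Qed.

(** If some entry has negative degree, it is zero and so is the brace;
    otherwise the degrees are those of the pairs. *)
Lemma dsum_gr_brace x xs : dsum_gr O (hdeg x + hdegs xs + 1) (brace (hval x) (hvals xs)).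
Proof.
have [x0|x0] := ltP (hdeg x) 0.
  by rewrite hdeg_lt0 // (lin0 (@brace_linl _ _ _)).
have [xs0|/negP] := boolP (all (fun y => 0 <= hdeg y) xs); last first.
  move/negP; rewrite -has_predC => /split_find [y s1 s2 + _]; rewrite /= -ltNge => y0.
  rewrite /hvals map_cat map_rcons !cat_rcons (hdeg_lt0 y0).
  by rewrite (lin0 (@brace_linr _ _ _ _ _)).
rewrite -emb_tag_homog hvals_tag_homog brace_emb; apply: dsum_gr_eq (@dsum_gr_emb _ _ _) _.
rewrite tag_tbrace (hdeg_tag_homog x0).
suff -> : hdegs xs = deg (map (@tag_homog k O) xs) by lia.
elim: xs xs0 => [|y xs IH]; first by rewrite /hdegs big_nil.
by move=> /andP[y0 xs0];
  rewrite /hdegs big_cons -/(hdegs xs) IH // (hdeg_tag_homog y0) deg_cons.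
Qed.

Lemma dsum_gr_cup n m (u v : V) :
  dsum_gr O n u -> dsum_gr O m v -> dsum_gr O (n + m) (cup mu u v).
Proof.
move=> gu gv; have [n0|n0] := leP n 0.
  by rewrite (dsum_gr_le0 gu n0) cup0l.
have [m0|m0] := leP m 0.
  by rewrite (dsum_gr_le0 gv m0) cup0r.
rewrite -[u](emb_tag_homog (Homog gu)) -[v](emb_tag_homog (Homog gv)).
rewrite cup_emb -[_ *: _]addr0 hbrE.
apply: dsum_gr_lin => //; apply: dsum_gr_eq (@dsum_gr_emb _ _ _) _.
by rewrite tag_tbrace /deg /= /hdeg /=; lia.
Qed.

Lemma dsum_gr_odiff n (u : V) : dsum_gr O n u -> dsum_gr O (n + 1) (odiff mu u).
Proof.
move=> gu; have [n0|n0] := leP n 0.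
  by rewrite (dsum_gr_le0 gu n0) (lin0 (@odiff_linear _ _ mu)).
rewrite -[u](emb_tag_homog (Homog gu)) odiff_emb [X in dsum_gr _ _ X]addrC -scaleNr !hbrE.
apply: dsum_gr_lin; apply: dsum_gr_eq (@dsum_gr_emb _ _ _) _;
  by rewrite tag_tbrace /deg /= /hdeg /=; lia.
Qed.

Lemma path_leq0 s : path leq 0 s = sorted leq s.
Proof. by case: s. Qed.

Lemma homog_brace_brace x xs ys :
    brace (brace (hval x) (hvals xs)) (hvals ys) =
    \sum_(i : (size xs).-tuple 'I_(size ys).+1)
    \sum_(j : (size xs).-tuple 'I_(size ys).+1 |
            interleaved (zip (map val i) (map val j)))
      sg k (insert_sign (map val i) xs ys) *:
      brace (hval x)
        (insert_args (@brace k O) 0 (zip (map val i) (map val j)) (hvals xs) (hvals ys)).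
Proof.
rewrite -emb_tag_homog !hvals_tag_homog brace_brace.
have := isum_tuples (fun t => brace (emb (tag_homog x)) (map emb t))
  (map (@tag_homog k O) xs) (leq0n (size (map (@tag_homog k O) ys))).
rewrite take0 muln0 scale1r drop0 => <-; rewrite !size_map.
apply: eq_bigr => i _; apply: eq_big => [j|j _]; first exact: path_leq0.
by rewrite insert_args_emb (sg_odd _ (odd_insert_sign _ _ _)).
Qed.

Theorem multiplicative_operad_homotopyG :
  is_homotopyG (dsum_gr O) (@brace k O) (cup mu) (odiff mu).
Proof.
split.
- exact: dsum_grading.
- by move=> xs; apply: brace_linl.
- by move=> x s1 s2; apply: brace_linr.
- exact: brace_nil.
- exact: dsum_gr_brace.
- by move=> y; apply: cup_linl.
- by move=> x; apply: cup_linr.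
- exact: dsum_gr_cup.
- exact: odiff_linear.
- exact: dsum_gr_odiff.
- exact: homog_brace_brace.
- exact: cupA.
- exact: odiff_odiff.
- move=> x y; rewrite -(emb_tag_homog x) -(emb_tag_homog y) odiff_cup //.
  congr (_ + _ *: _).
  by rewrite (@sg_odd _ _ (tag (tag_homog x)).+1) // odd_abszD addbT.
- move=> x y zs; rewrite -(emb_tag_homog x) -(emb_tag_homog y).
  rewrite !hvals_tag_homog cup_brace size_map.
  apply: eq_bigr => l _; rewrite !hvals_tag_homog !map_take !map_drop; congr (_ *: _).
  apply/esym/sg_odd; rewrite abszM !oddM odd_abszD addbT -map_take.
  by rewrite odd_hdegs.
move=> x [//|y ys] _ N v sd; pose X := map (@tag_homog k O) (y :: ys).
have sdE i : sg k (sd i) = (-1) ^+ deg (take i X).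
  by apply: sg_odd; rewrite odd_hdegs map_take.
have sdxE i : sg k (hdeg x + sd i) = (-1) ^+ (tag (tag_homog x) + deg (take i X)).
  by apply: sg_odd; rewrite odd_abszD oddD odd_hdegs map_take.
have vE : v = map emb X by exact: hvals_tag_homog.
have -> : sg k ((hdeg x + 1) * sd 1%N) = (-1) ^+ ((tag (tag_homog x)).+1 * deg (take 1 X)).
  by apply: sg_odd; rewrite abszM !oddM odd_abszD addbT odd_hdegs map_take.
rewrite sdxE !sgE -(emb_tag_homog x).
under eq_bigr => i _ do rewrite sdE.
under [in RHS]eq_bigr => i _ do rewrite sdE.
have := odiff_brace mu (tag_homog x) (tag_homog y) (map (@tag_homog k O) ys).
cbv zeta; rewrite -[tag_homog y :: _]/X -vE !size_map => E.
exact: E.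
Qed.

End HomotopyGAxioms.

(** * The operad of cochains over the 2-sphere *)

Theorem lemma4p5 (k : fieldType) (A : comAlgType k) :
  is_multiplication (S2_mult A) /\
  is_homotopyG (dsum_gr (S2_operad A)) (brace (O := S2_operad A))
    (cup (S2_mult A)) (odiff (S2_mult A)).
Proof.
suff muP : is_multiplication (S2_mult A).
  by split=> //; apply: multiplicative_operad_homotopyG.
rewrite /is_multiplication /circ big_ord_recl big_ord_recl big_ord0 addr0.
rewrite /= expr0 scale1r expr1 scaleN1r; apply/eqP; rewrite subr_eq0; apply/eqP.
apply: val_inj; apply: functional_extensionality_dep => T /=.
rewrite /S2_pcomp_fun /= !ffunE.
pose t01 : tri (1 + 1).+1 := tri_blk (ord0 : 'I_2) tri01.
pose t12 : tri (1 + 1).+1 := tri_blk (lift ord0 ord0 : 'I_2) tri01.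
pose t02 : tri (1 + 1).+1 :=
  exist (fun pq : 'I_3 * 'I_3 => (pq.1 < pq.2)%N) (ord0, ord_max) isT.
have triE (s t : tri 3) :
    (s == t) = (tri_row s == tri_row t :> nat) && (tri_col s == tri_col t :> nat).
  by apply/eqP/andP => [->|[/eqP rr /eqP cc]] //; apply: tri_eq.
(* Entry t02 survives in the outer array of both composites; of the other two,
   one is the inner array and one is multiplied with t02. *)
rewrite (bigD1 t02) //= [X in _ * X * _ = _](big_pred1 t12); last first.
  move=> t; rewrite /= !triE; case: t => [[[p pl] [q ql]] pq].
  move: pl ql pq; rewrite /tri_row /tri_col /=.
  by move: p q => [|[|[|p]]] [|[|[|q]]].
rewrite [in RHS](bigD1 t02) //= [X in _ = _ * X * _](big_pred1 t01); last first.
  move=> t; rewrite /= !triE; case: t => [[[p pl] [q ql]] pq].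
  move: pl ql pq; rewrite /tri_row /tri_col /=.
  by move: p q => [|[|[|p]]] [|[|[|q]]].
by rewrite mulrAC.
Qed.
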